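(* Let $h=\hat h\circ\tilde h:\Sigma^c\to\mathcal R$ be a random tornado tabulation hash function with $d$ derived characters, let $Q\subseteq\Sigma^c$ be a set of query keys and $f$ a selector function with query keys $Q$. If $\mu^f\le|\Sigma|/2$, then the set of derived selected keys $\tilde h(X^{f,h})$ is linearly dependent with probability at most $$\mathsf{DependenceProb}(\mu^f,d,\Sigma):=7(\mu^f)^3\left(\frac{3}{|\Sigma|}\right)^{d+1}+\frac{1}{2^{|\Sigma|/2}}.$$
   Context: Let $\Sigma=\{0,1,\dots,2^k-1\}$ be an alphabet of characters, identified with $k$-bit strings, where $\oplus$ denotes bitwise xor; throughout $|\Sigma|\ge 2^8$. Let $\mathcal R=\{0,\dots,2^r-1\}$, viewed as $r$-bit strings. A simple tabulation hash function $g:\Sigma^b\to\mathcal R'$ is $g(x_1\cdots x_b)=T_1[x_1]\oplus\cdots\oplus T_b[x_b]$ with independent fully random tables $T_i:\Sigma\to\mathcal R'$. A random tornado tabulation hash function $h:\Sigma^c\to\mathcal R$ with $d\ge1$ derived characters consists of mutually independent simple tabulation functions $\tilde h_i:\Sigma^{c+i-1}\to\Sigma$ ($i=0,\dots,d$) and $\hat h:\Sigma^{c+d}\to\mathcal R$; for $x=x_1\cdots x_c$ the derived key $\tilde h(x)=\tilde x_1\cdots\tilde x_{c+d}$ has $\tilde x_i=x_i$ for $i<c$, $\tilde x_c=x_c\oplus\tilde h_0(\tilde x_1\cdots\tilde x_{c-1})$, $\tilde x_i=\tilde h_{i-c}(\tilde x_1\cdots\tilde x_{i-1})$ for $c<i\le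 c+d$, and $h(x)=\hat h(\tilde h(x))$. A selector function with query keys $Q\subseteq\Sigma^c$ is a function $f:\Sigma^c\times\mathcal R\times\mathcal R^Q\to\{0,1\}$ with $f(q,\cdot,\cdot)=1$ for all $q\in Q$. The selected set is $X^{f,h}=\{x\in\Sigma^c: f(x,h(x),h|_Q)=1\}$. Define $p^f_x=\max_{\varphi\in\mathcal R^Q}\Pr_{r\sim\mathcal U(\mathcal R)}[f(x,r,\varphi)=1]$ and $\mu^f=\sum_{x\in\Sigma^c}p^f_x$. A set $Y\subseteq\Sigma^b$ of keys is linearly dependent if there is a nonempty $Y'\subseteq Y$ such that for every position $i\in\{1,\dots,b\}$ and every character $a\in\Sigma$, the number of $y\in Y'$ with $y_i=a$ is even; otherwise it is linearly independent. *)

(* Defs.v *)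
From mathcomp Require Import all_boot all_order all_algebra.
Set Implicit Arguments. Unset Strict Implicit. Unset Printing Implicit Defensive.
Import Order.TTheory GRing.Theory Num.Theory.

Definition bits (n : nat) := {ffun 'I_n -> bool}.
Definition bzero (n : nat) : bits n := [ffun => false].
Definition bxor (n : nat) (x y : bits n) : bits n := [ffun i => x i (+) y i].

Definition key (k b : nat) := {ffun 'I_b -> bits k}.

(* xor of table lookups T p (s_p) over the positions p < size s (and p < m);
   this is simple tabulation applied to the key s of length size s <= m *)
Definition tab (k r m : nat) (T : {ffun 'I_m -> {ffun bits k -> bits r}})
    (s : seq (bits k)) : bits r :=
  \big[@bxor r/bzero r]_(p < m | p < size s) T p (nth (bzero k) s p).

(* tables of the tornado hash: Ttil i = tables of h~_i (i = 0..d); only the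
   first c+i-1 positions of Ttil i are used; Thatp = tables of h^ *)
Definition tables (k r c d : nat) :=
  ({ffun 'I_d.+1 -> {ffun 'I_(c + d) -> {ffun bits k -> bits k}}}
   * {ffun 'I_(c + d) -> {ffun bits k -> bits r}})%type.

Definition keyn (k c : nat) (x : key k c) (j : nat) : bits k :=
  if insub j is Some i then x i else bzero k.

(* 0-indexed position j of the derived key, given the prefix s of length j *)
Definition derived_next (k c d : nat)
    (Tt : {ffun 'I_d.+1 -> {ffun 'I_(c + d) -> {ffun bits k -> bits k}}})
    (x : key k c) (j : nat) (s : seq (bits k)) : bits k :=
  if j < c.-1 then keyn x j
  else if j == c.-1 then bxor (keyn x j) (tab (Tt (inord 0)) s)
  else tab (Tt (inord (j - c).+1)) s.

Fixpoint derived_prefix (k c d : nat)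
    (Tt : {ffun 'I_d.+1 -> {ffun 'I_(c + d) -> {ffun bits k -> bits k}}})
    (x : key k c) (n : nat) : seq (bits k) :=
  match n with
  | 0 => [::]
  | n'.+1 => let s := derived_prefix Tt x n' in rcons s (derived_next Tt x n' s)
  end.

Definition derived_key (k r c d : nat) (w : tables k r c d) (x : key k c)
    : key k (c + d) :=
  [ffun j : 'I_(c + d) => nth (bzero k) (derived_prefix w.1 x (c + d)) j].

Definition tornado (k r c d : nat) (w : tables k r c d) (x : key k c) : bits r :=
  \big[@bxor r/bzero r]_(p < c + d) w.2 p (derived_key w x p).

Definition qtype (k c : nat) (Q : {set key k c}) := {x : key k c | x \in Q}.

Definition restrictQ (k r c d : nat) (Q : {set key k c}) (w : tables k r c d)
    : {ffun qtype Q -> bits r} := [ffun q => tornado w (val q)].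

Definition selector (k r c : nat) (Q : {set key k c})
    (f : key k c -> bits r -> {ffun qtype Q -> bits r} -> bool) : Prop :=
  forall q rr phi, q \in Q -> f q rr phi.

Definition selected (k r c d : nat) (Q : {set key k c})
    (f : key k c -> bits r -> {ffun qtype Q -> bits r} -> bool)
    (w : tables k r c d) : {set key k c} :=
  [set x | f x (tornado w x) (restrictQ Q w)].

Local Open Scope ring_scope.

Definition pf (k r c : nat) (Q : {set key k c})
    (f : key k c -> bits r -> {ffun qtype Q -> bits r} -> bool) (x : key k c) : rat :=
  (\max_(phi : {ffun qtype Q -> bits r}) #|[set rr : bits r | f x rr phi]|)%N%:R
  / #|{: bits r}|%:R.

Definition muf (k r c : nat) (Q : {set key k c})
    (f : key k c -> bits r -> {ffun qtype Q -> bits r} -> bool) : rat :=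
  \sum_(x : key k c) pf f x.

Definition lin_dependent (k b : nat) (Y : {set key k b}) : bool :=
  [exists Y' : {set key k b},
     [&& Y' != set0, Y' \subset Y &
      [forall i : 'I_b, forall a : bits k, ~~ odd #|[set y in Y' | y i == a]|]]].

(* probability over uniformly random (fully independent) tables *)
Definition Pr (T : finType) (E : pred T) : rat := #|[set w | E w]|%:R / #|{: T}|%:R.

(* Main.v *)
(* Write [n] for the alphabet size. Simple tabulation is linear in its tables, so it is
   jointly uniform on keys whose position characters are independent over the field with
   two elements. This is applied to each level in turn, given the tables of the lower ones.

   If the derived selected keys are dependent, take a dependent set [Z] of selected keys
   with as few non-query keys as possible, and then as few keys as possible. The last two
   derived characters induce two perfect matchings of [Z]. Peeling off one edge at a time
   along the alternating cycles of their union gives a smallest family of alternating paths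
   and cycles, on [2w] keys, whose edges at level [d - 1] are dependent; all but one of
   these edges are independent, and so are the [w - 1] edges at level [d]. Hence a fixed
   such structure has probability at most [n^-(2w-2)] times the product of the selection
   probabilities of [2w - 1] of its keys, and the last key is determined by the others
   because it lies in a set of keys that is dependent at the lower levels. Each lower level
   costs a further factor [3 / n]: a minimal dependent set of [2v] keys has [(2v-1)!!]
   matchings, each of probability [n^-(v-1)], and [v = 2] dominates. Choosing the removed
   non-query key of [Z] as the last key keeps the remaining keys independent together with
   the queries, so their hash values are uniform. Structures with [w] above [9n / 32] are
   cut at that size and give the term [2^-(n/2)]. *)

Require Import Defs.
From Stdlib Require Import NArith.
From mathcomp Require Import all_boot all_order all_algebra.
From mathcomp Require Import zify ring lra.
Set Implicit Arguments. Unset Strict Implicit. Unset Printing Implicit Defensive.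
Import Order.TTheory GRing.Theory Num.Theory.

Local Open Scope ring_scope.

(** * Uniform distributions on finite types *)

Lemma Pr_ge0 (T : finType) (E : pred T) : 0 <= Pr E.
Proof. by rewrite divr_ge0 ?ler0n. Qed.

Lemma le_Pr (T : finType) (E F : pred T) : (forall w, E w -> F w) -> Pr E <= Pr F.
Proof.
move=> sEF; rewrite ler_wpM2r ?invr_ge0 ?ler0n // ler_nat; apply: subset_leq_card.
by apply/subsetP => w; rewrite !inE; apply: sEF.
Qed.

Lemma Pr_le1 (T : finType) (E : pred T) : Pr E <= 1.
Proof.
rewrite /Pr; case: (posnP #|T|) => [->|T0]; first by rewrite invr0 mulr0.
by rewrite ler_pdivrMr ?ltr0n // mul1r ler_nat max_card.
Qed.

Lemma Pr_neq0 (T : finType) (E : pred T) : Pr E != 0 -> exists w, E w.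
Proof.
rewrite mulf_eq0 pnatr_eq0 cards_eq0 negb_or => /andP[/set0Pn[w]].
by rewrite inE; exists w.
Qed.

Lemma PrE (T : finType) (E : pred T) : Pr E = (\sum_(w | E w) 1) / #|T|%:R.
Proof. by rewrite /Pr cardsE -sum1_card natr_sum. Qed.

Lemma union_bound (T I : finType) (P : pred I) (E : pred T) (F : I -> pred T) :
  (forall w, E w -> exists2 i, P i & F i w) -> Pr E <= \sum_(i | P i) Pr (F i).
Proof.
move=> coverE; rewrite /Pr -mulr_suml ler_wpM2r ?invr_ge0 ?ler0n // -natr_sum ler_nat.
apply: (@leq_trans #|\bigcup_(i | P i) [set w | F i w]|).
  apply: subset_leq_card; apply/subsetP => w; rewrite inE => /coverE[i Pi Fi].
  by apply/bigcupP; exists i; rewrite ?inE.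
elim/big_rec2: _ => [|i s A _ leA]; first by rewrite cards0.
by apply: leq_trans (leq_card_setU _ _) _; rewrite leq_add2l.
Qed.

Lemma Pr_exists_le (T I : finType) (P : pred I) (F : I -> pred T) :
  Pr (fun w => [exists (i | P i), F i w]) <= \sum_(i | P i) Pr (F i).
Proof. by apply: union_bound => w /existsP[i /andP[Pi Fi]]; exists i. Qed.

Lemma Pr_orb_le (T : finType) (E F : pred T) : Pr (fun w => E w || F w) <= Pr E + Pr F.
Proof.
rewrite -[leRHS](big_bool _ (fun b => Pr (if b then E else F))).
by apply: union_bound => w /orP[Ew|Fw]; [exists true|exists false].
Qed.

(* Resampling by injections that preserve [E] does not change the joint law of [E] and [C]. *)
Lemma Pr_resample_le (Om T : finType) (resample : T -> Om -> Om) (E C : pred Om) (b : rat) :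
  (0 < #|T|)%N -> (forall t, injective (resample t)) ->
  (forall t w, E (resample t w) = E w) ->
  (forall w, E w -> Pr (fun t => C (resample t w)) <= b) ->
  Pr (fun w => E w && C w) <= b * Pr E.
Proof.
move=> T0 inj_rs E_rs Cb; rewrite !PrE mulrA ler_wpM2r ?invr_ge0 ?ler0n //.
rewrite -(ler_pM2l (_ : 0 < #|T|%:R)) ?ltr0n //.
have -> : #|T|%:R * (\sum_(w | E w && C w) 1) =
    \sum_(w | E w) \sum_(t | C (resample t w)) 1 :> rat.
  rewrite (exchange_big_dep predT) //= -sum1_card natr_sum mulr_suml.
  apply: eq_bigr => t _; rewrite mul1r (reindex_inj (inj_rs t)) /=.
  by apply: eq_bigl => w; rewrite E_rs.
rewrite mulrCA !mulr_sumr; apply: ler_sum => w Ew; rewrite mulr1.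
by have := Cb w Ew; rewrite PrE ler_pdivrMr ?ltr0n.
Qed.

(** * Zero sums *)

Section ZeroSums.
Variables (K : finType) (M : zmodType) (rho : K -> M).
Implicit Types V W C : {set K}.

Definition zero_sum V := \sum_(x in V) rho x == 0.

Definition zero_sum_free V :=
  [forall W : {set K}, (W \subset V) && (W != set0) ==> ~~ zero_sum W].

Definition circuit V :=
  [&& V != set0, zero_sum V &
      [forall W : {set K}, [&& W \subset V, W != set0 & zero_sum W] ==> (W == V)]].

Lemma zero_sum_freeP V : reflect
  (forall W, W \subset V -> zero_sum W -> W = set0) (zero_sum_free V).
Proof.
apply: (iffP forallP) => [freeV W sWV zW|freeV W].
  by apply: contraTeq zW => W0; have /implyP-> := freeV W; rewrite ?sWV.
by apply/implyP => /andP[sWV]; apply: contra => zW; rewrite (freeV W).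
Qed.

Lemma circuit_min V W : circuit V -> W \subset V -> W != set0 -> zero_sum W -> W = V.
Proof.
move=> /and3P[_ _ /forallP/(_ W)/implyP minV] sWV W0 zW.
by apply/eqP/minV; rewrite sWV W0.
Qed.

Lemma zero_sumD V W : zero_sum V -> zero_sum W -> W \subset V -> zero_sum (V :\: W).
Proof.
move=> zV /eqP zW sWV; move: zV; rewrite /zero_sum (big_setID W) /=.
by rewrite (setIidPr sWV) zW add0r.
Qed.

Lemma zero_sum_circuit V x : zero_sum V -> x \in V ->
  exists C, [/\ circuit C, x \in C & C \subset V].
Proof.
elim: {V}_.+1 {-2}V (ltnSn #|V|) => // m IH V ltV zV xV.
have [cV|] := boolP (circuit V); first by exists V.
rewrite /circuit zV (_ : V != set0) /=; last by apply/set0Pn; exists x.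
rewrite negb_forall => /existsP[W]; rewrite negb_imply => /andP[/and3P[sW W0 zW] neW].
suff [V' [ltV' zV' xV' sV']] :
    exists V', [/\ #|V'| < m, zero_sum V', x \in V' & V' \subset V]%N.
  have [C [cC xC sC]] := IH V' ltV' zV' xV'.
  by exists C; split=> //; apply: subset_trans sC sV'.
have [xW|xW] := boolP (x \in W).
  exists W; split=> //; apply: leq_trans (proper_card _) ltV.
  by rewrite properEneq neW sW.
exists (V :\: W); split; rewrite ?zero_sumD ?subsetDl ?inE ?xW //.
rewrite -ltnS (leq_trans _ ltV) // ltnS cardsD (setIidPr sW) ltn_subrL card_gt0 W0.
by apply/card_gt0P; exists x.
Qed.

End ZeroSums.

Definition exponent_two (V : zmodType) := forall v : V, v + v = 0.

Lemma exponent_two_bool : exponent_two bool.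
Proof. by case. Qed.

Lemma exponent_two_ffun (I : finType) (V : zmodType) :
  exponent_two V -> exponent_two {ffun I -> V}.
Proof. by move=> V2 v; apply/ffunP => i; rewrite !ffunE V2. Qed.

(* The additions of [bits n] and [key k c] are those of finite functions into the Boolean
   field; on [bits n], [+%R] and [0] are convertible to [bxor] and [bzero]. *)
Lemma exponent_two_bits n : exponent_two (bits n).
Proof. exact: exponent_two_ffun exponent_two_bool. Qed.

Lemma exponent_two_key k c : exponent_two (key k c).
Proof. exact: exponent_two_ffun (@exponent_two_bits k). Qed.

Lemma exponent_two_addr_eq0 (V : zmodType) (v w : V) :
  exponent_two V -> (v + w == 0) = (v == w).
Proof. by move/(_ v)/eqP; rewrite !addr_eq0 -[v == - w]eqr_oppLR => /eqP <-. Qed.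

Lemma mulrb_addb (V : zmodType) (v : V) (b c : bool) :
  exponent_two V -> v *+ (b + c)%R = v *+ b + v *+ c.
Proof. by case: b c => [] []; rewrite ?addr0 ?add0r // => ->. Qed.

Lemma mulrb_sum (V : zmodType) (I : finType) (v : V) (b : I -> bool) :
  exponent_two V -> v *+ (\sum_i b i)%R = \sum_i v *+ b i.
Proof. by move=> v2; apply: (big_morph (fun c : bool => v *+ c)) => // x y; apply: mulrb_addb. Qed.

Section DualBasis.
Variables (F : fieldType) (K P : finType) (A : {set K}) (u : K -> P -> F).
Hypothesis free_u : forall a : K -> F,
  (forall p, \sum_(x in A) a x * u x p = 0) -> {in A, forall x, a x = 0}.

Lemma dual_basis :
  exists D : K -> P -> F, {in A &, forall x y, \sum_p u x p * D y p = (x == y)%:R}.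
Proof.
case: (set_0Vmem A) => [A0|[x0 Ax0]].
  by exists (fun _ _ => 0) => x y; rewrite A0 inE.
pose idx := enum_rank_in Ax0.
pose N : 'M[F]_(#|A|, #|P|) := \matrix_(i, j) u (enum_val i) (enum_val j).
have /row_freeP[B NB1] : row_free N.
  apply: inj_row_free => v vN0; apply/rowP => i; rewrite mxE.
  have /(_ _ _ (enum_valP i)) := free_u (a := fun x => v 0 (idx x)).
  rewrite /idx enum_valK_in; apply=> p.
  have /rowP/(_ (enum_rank p)) := vN0; rewrite !mxE => vNp.
  rewrite -[RHS]vNp big_enum_val; apply: eq_bigr => j _.
  by rewrite mxE enum_valK_in enum_rankK.
exists (fun y p => B (enum_rank p) (idx y)) => x y Ax Ay.
have /matrixP/(_ (idx x) (idx y)) := NB1; rewrite !mxE.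
rewrite (can_in_eq (enum_rankK_in Ax0)) // => <-.
rewrite (reindex_onto enum_rank enum_val) /=; last by move=> j _; rewrite enum_valK.
apply: eq_big => [p|p _]; first by rewrite enum_rankK eqxx.
by rewrite mxE enum_rankK enum_rankK_in.
Qed.

End DualBasis.

Lemma zero_sum_free_dual (K P : finType) (A : {set K}) (u : K -> {ffun P -> bool}) :
  zero_sum_free u A ->
  exists D : K -> P -> bool, {in A &, forall x y, \sum_p u x p * D y p = (x == y)%:R}.
Proof.
move=> /zero_sum_freeP free_u; apply: dual_basis => a a0 x Ax.
have /setP/(_ x) : [set y in A | a y] = set0; last by rewrite !inE Ax /= => ->.
apply: free_u; first by apply/subsetP => y; rewrite inE => /andP[].
apply/eqP/ffunP => p; rewrite sum_ffunE ffunE -[RHS](a0 p).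
rewrite big_mkcond [RHS]big_mkcond; apply: eq_bigr => y _; rewrite inE.
by case: (y \in A); case: (a y); rewrite ?mul1r ?mul0r.
Qed.

(** * Simple tabulation *)

Section Lookup.
Variables (I B : finType).

(* The value of the tables [U] on a formal sum [u] of position characters over the field
   with two elements. *)
Definition lookup (M : zmodType) (U : {ffun I -> {ffun B -> M}}) (u : {ffun I * B -> bool}) : M :=
  \sum_p U p.1 p.2 *+ u p.

Lemma lookupDl (M : zmodType) (U U' : {ffun I -> {ffun B -> M}}) u :
  lookup (U + U') u = lookup U u + lookup U' u.
Proof. by rewrite -big_split; apply: eq_bigr => p _; rewrite !ffunE mulrnDl. Qed.

Lemma lookupDr (M : zmodType) (U : {ffun I -> {ffun B -> M}}) u v :
  exponent_two M -> lookup U (u + v) = lookup U u + lookup U v.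
Proof. by move=> M2; rewrite -big_split; apply: eq_bigr => p _; rewrite ffunE mulrb_addb. Qed.

Lemma lookup_sum (M : zmodType) (U : {ffun I -> {ffun B -> M}}) (K : finType) (A : {set K}) u :
  exponent_two M ->
  lookup U (\sum_(x in A) u x) = \sum_(x in A) lookup U (u x).
Proof.
move=> M2; apply: (big_morph (lookup U)) => [v w|]; first exact: lookupDr.
by rewrite /lookup big1 // => p _; rewrite ffunE.
Qed.

Lemma lookup_surj (M : zmodType) (K : finType) (A : {set K}) (u : K -> {ffun I * B -> bool})
    (h : K -> M) : exponent_two M -> zero_sum_free u A ->
  exists U : {ffun I -> {ffun B -> M}}, {in A, forall x, lookup U (u x) = h x}.
Proof.
move=> M2 /zero_sum_free_dual[D uD].
exists [ffun p => [ffun b => \sum_(x in A) h x *+ D x (p, b)]] => y Ay.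
rewrite /lookup; under eq_bigr do rewrite !ffunE -sumrMnl.
rewrite exchange_big.
under eq_bigr => x Ax.
  under eq_bigr do rewrite -surjective_pairing -mulrnA mulnb andbC.
  rewrite -mulrb_sum // uD //; over.
rewrite /= (bigD1 y Ay) /= eqxx big1 ?addr0 // => x /andP[_ xy].
by rewrite eq_sym (negbTE xy).
Qed.

Section Uniformity.
Variables (s : nat) (K : finType) (A : {set K}) (u : K -> {ffun I * B -> bool}).
Hypothesis free_u : zero_sum_free u A.
Local Notation table := {ffun I -> {ffun B -> bits s}}.

Definition lookup_fiber (h : K -> bits s) : {set table} :=
  [set U : table | [forall x in A, lookup U (u x) == h x]].

Lemma card_lookup_fiber g h : #|lookup_fiber g| = #|lookup_fiber h|.
Proof.
have [T uT] := lookup_surj (fun x => g x - h x) (@exponent_two_bits s) free_u.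
rewrite -(card_preimset (lookup_fiber g) (addIr T)).
apply: eq_card => U; rewrite !inE; apply: eq_forallb_in => x Ax.
by rewrite lookupDl uT // addrCA -[X in _ == X]addr0 (inj_eq (addrI _)) subr_eq0.
Qed.

Lemma card_lookup_tables g : #|{: table}| = (#|{: bits s}| ^ #|A| * #|lookup_fiber g|)%N.
Proof.
pose values (U : table) := [ffun x => if x \in A then lookup U (u x) else 0].
pose supported := pffun_on (0 : bits s) (mem A) (mem {: bits s}).
have <- : #|supported| = (#|{: bits s}| ^ #|A|)%N by exact: card_pffun_on.
rewrite -sum_nat_const -[LHS]sum1_card (partition_big values (mem supported)) /=; last first.
  move=> U _; apply/pffun_onP; split=> //; apply/subsetP => x.
  by rewrite inE ffunE; case: ifP; rewrite ?eqxx.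
apply: eq_bigr => h /pffun_onP[/subsetP supp_h _].
rewrite sum1dep_card (card_lookup_fiber g h); apply: eq_card => U; rewrite !inE.
apply/eqP/forall_inP => [<- x Ax|eqUh]; first by rewrite ffunE Ax.
apply/ffunP => x; rewrite ffunE; case: ifP => [/eqUh/eqP //|/negbT xA].
by apply/esym/eqP; apply: contraNT xA => /supp_h.
Qed.

Lemma Pr_lookup_eq (g : K -> bits s) :
  Pr (fun U : table => [forall x in A, lookup U (u x) == g x]) = #|{: bits s}|%:R ^- #|A|.
Proof.
have fiber0 : #|lookup_fiber g|%:R != 0 :> rat.
  have [U uU] := lookup_surj g (@exponent_two_bits s) free_u.
  rewrite pnatr_eq0 -lt0n; apply/card_gt0P; exists U; rewrite inE.
  by apply/forall_inP => x /uU->.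
by rewrite /Pr (card_lookup_tables g) natrM natrX invfM mulrCA divff ?mulr1.
Qed.

End Uniformity.

End Lookup.

(** * Perfect matchings *)

Local Close Scope ring_scope.

(* The double factorial [(2m-1)!!]. *)
Definition odd_fact m := \prod_(j < m) j.*2.+1.

Lemma odd_factS m : odd_fact m.+1 = odd_fact m * m.*2.+1.
Proof. by rewrite /odd_fact big_ord_recr. Qed.

Section Matchings.
Variable K : finType.
Implicit Types (V W S B : {set K}) (a b : K -> K) (x y : K).

Definition stable a V := [forall x in V, a x \in V].
Definition matching a V := [forall x in V, [&& a x \in V, a x != x & a (a x) == x]].
Definition edge a x := [set x; a x].
Definition restrict V a : {ffun K -> K} := [ffun x => if x \in V then a x else x].

(* A matching of [V] is represented by the involution that fixes the points outside [V]. *)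
Definition matchings V : {set {ffun K -> K}} :=
  [set a : {ffun K -> K} | matching a V && (restrict V a == a)].

Lemma stableP a V x : stable a V -> x \in V -> a x \in V.
Proof. by move=> /forall_inP/(_ x). Qed.

Lemma matchingP a V x : matching a V -> x \in V -> [/\ a x \in V, a x != x & a (a x) = x].
Proof. by move=> /forall_inP/(_ x) h /h /and3P[? ? /eqP]. Qed.

Lemma matching_stable a V : matching a V -> stable a V.
Proof. by move=> aV; apply/forall_inP => x /(matchingP aV)[]. Qed.

Lemma matching_sub a V W : matching a V -> W \subset V -> stable a W -> matching a W.
Proof.
move=> aV sWV aW; apply/forall_inP => x Wx; rewrite (stableP aW Wx) /=.
by have [_ -> ->] := matchingP aV (subsetP sWV _ Wx); rewrite eqxx.
Qed.

Lemma stableD a V W : matching a V -> stable a W -> stable a (V :\: W).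
Proof.
move=> aV aW; apply/forall_inP => x; rewrite !inE => /andP[Wx Vx].
have [-> _ aax] := matchingP aV Vx; rewrite andbT; apply: contra Wx => /(stableP aW).
by rewrite aax.
Qed.

Lemma eq_matching a b V : {in V, a =1 b} -> matching a V = matching b V.
Proof.
move=> eq_ab; rewrite /matching; apply: eq_forallb_in => x Vx; rewrite -(eq_ab x Vx).
by case: (boolP (a x \in V)) => //= /eq_ab->.
Qed.

Lemma eq_stable a b V : {in V, a =1 b} -> stable a V = stable b V.
Proof. by move=> eq_ab; rewrite /stable; apply: eq_forallb_in => x Vx; rewrite eq_ab. Qed.

Lemma restrictE V a : {in V, restrict V a =1 a}.
Proof. by move=> x Vx; rewrite ffunE Vx. Qed.

Lemma restrict_matchings V a : matching a V -> restrict V a \in matchings V.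
Proof.
move=> aV; rewrite inE (eq_matching (@restrictE V a)) aV /=.
by apply/eqP; apply/ffunP => x; rewrite !ffunE; case: ifP => // ->.
Qed.

Lemma matchings_matching V (a : {ffun K -> K}) : a \in matchings V -> matching a V.
Proof. by rewrite inE => /andP[]. Qed.

Lemma matchings_out V (a : {ffun K -> K}) x : a \in matchings V -> x \notin V -> a x = x.
Proof. by rewrite inE => /andP[_ /eqP <-] /negPf xV; rewrite ffunE xV. Qed.

Lemma edge_sub a V x : matching a V -> x \in V -> edge a x \subset V.
Proof. by move=> aV Vx; have [Vax _ _] := matchingP aV Vx; rewrite subUset !sub1set Vx. Qed.

Lemma edge_stable a V x : matching a V -> x \in V -> stable a (edge a x).
Proof.
move=> aV Vx; have [_ _ aax] := matchingP aV Vx.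
by apply/forall_inP => y; rewrite !inE => /orP[] /eqP->; rewrite ?aax eqxx ?orbT.
Qed.

Lemma stableD_edge a V x : matching a V -> x \in V -> stable a (V :\: edge a x).
Proof. by move=> aV Vx; apply: stableD (edge_stable aV Vx). Qed.

Lemma matchingD_edge a V x : matching a V -> x \in V -> matching a (V :\: edge a x).
Proof.
by move=> aV Vx; apply: matching_sub aV (subsetDl _ _) (stableD_edge aV Vx).
Qed.

Lemma cardsD_edge a V x : matching a V -> x \in V -> #|V| = #|V :\: edge a x|.+2.
Proof.
move=> aV Vx; rewrite -(cardsID (edge a x) V) (setIidPr (edge_sub aV Vx)) cards2.
by have [_ axx _] := matchingP aV Vx; rewrite eq_sym axx.
Qed.

Lemma card_matchings_through V x y : x \in V ->
  #|[set a in matchings V | a x == y]| <= #|matchings (V :\: [set x; y])|.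
Proof.
move=> Vx; pose through := [set a in matchings V | a x == y].
have throughP (a : {ffun K -> K}) : a \in through -> a \in matchings V /\ a x = y.
  by rewrite inE => /andP[? /eqP].
pose trim (a : {ffun K -> K}) := restrict (V :\: [set x; y]) a.
have trim_inj : {in through &, injective trim}.
  move=> a b /throughP[aV ax] /throughP[bV bx] /ffunP eq_ab; apply/ffunP => u.
  have := eq_ab u; rewrite !ffunE !inE.
  case: (eqVneq u x) => [->|_]; first by rewrite ax bx.
  have [_ _] := matchingP (matchings_matching aV) Vx.
  have [_ _] := matchingP (matchings_matching bV) Vx.
  rewrite ax bx; case: (eqVneq u y) => [-> -> ->|_ _ _] //=.
  by case: (boolP (u \in V)) => //= uV; rewrite (matchings_out aV) ?(matchings_out bV).
rewrite -(card_in_imset trim_inj).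
apply: subset_leq_card; apply/subsetP => _ /imsetP[a /throughP[aV ax] ->].
by apply: restrict_matchings; rewrite -ax; apply: matchingD_edge; rewrite ?matchings_matching.
Qed.

Lemma card_matchings m V : #|V| = m.*2 -> #|matchings V| <= odd_fact m.
Proof.
elim: m V => [|m IH] V cV.
  rewrite /odd_fact big_ord0 -(cards1 (restrict V id)).
  apply: subset_leq_card; apply/subsetP => a aV; rewrite inE; apply/eqP/ffunP => x.
  by rewrite ffunE if_same (matchings_out aV) // (cards0_eq cV) inE.
have /card_gt0P[x Vx] : 0 < #|V| by rewrite cV.
have cVx : #|V :\ x| = m.*2.+1 by move: cV; rewrite (cardsD1 x) Vx doubleS => -[].
have sub : matchings V \subset \bigcup_(y in V :\ x) [set a in matchings V | a x == y].
  apply/subsetP => a aV; have [axV axx _] := matchingP (matchings_matching aV) Vx.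
  apply/bigcupP; exists (a x); first by rewrite !inE axx.
  by apply/setIdP.
apply: leq_trans (subset_leq_card sub) _.
apply: (@leq_trans (\sum_(y in V :\ x) odd_fact m)); last first.
  by rewrite sum_nat_const cVx odd_factS mulnC.
elim/big_rec2: _ => [|y s A Vxy leA]; first by rewrite cards0.
apply: leq_trans (leq_card_setU _ _) _; rewrite leq_add //.
apply: leq_trans (card_matchings_through y Vx) _; apply: IH.
rewrite -setDDl; move: cVx; rewrite (cardsD1 y) Vxy => -[//].
Qed.

(* Equally labelled points are matched by swapping positions [2j] and [2j+1] in the
   enumeration of their common fibre. *)
Lemma even_fibers_matching (T : eqType) (f : K -> T) V :
  (forall t, ~~ odd #|[set x in V | f x == t]|) ->
  exists2 a, a \in matchings V & {in V, forall x, f (a x) = f x}.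
Proof.
move=> even_f; pose fiber x := enum [set y in V | f y == f x].
pose swap i := if odd i then i.-1 else i.+1.
have swapK i : swap (swap i) = i.
  by rewrite /swap; do 2!case: ifP; lia.
have swap_neq i : swap i != i by rewrite /swap; case: ifP; lia.
have swap_lt i m : ~~ odd m -> i < m -> swap i < m by rewrite /swap; case: ifP; lia.
pose a x := nth x (fiber x) (swap (index x (fiber x))).
have mem_fiber x y : (y \in fiber x) = (y \in V) && (f y == f x) by rewrite mem_enum inE.
have index_lt x : x \in V -> swap (index x (fiber x)) < size (fiber x).
  move=> Vx; apply: swap_lt; first by rewrite -cardE.
  by rewrite index_mem mem_fiber Vx eqxx.
have aP x : x \in V -> (a x \in V) /\ f (a x) = f x.
  by move=> /index_lt lt; have := mem_nth x lt; rewrite mem_fiber => /andP[? /eqP].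
have fiber_a x : x \in V -> fiber (a x) = fiber x.
  by move=> /aP[_ fax]; rewrite /fiber fax.
have index_a x : x \in V -> index (a x) (fiber x) = swap (index x (fiber x)).
  by move=> Vx; rewrite index_uniq ?enum_uniq ?index_lt.
have aV : matching a V.
  apply/forall_inP => x Vx; have [axV _] := aP x Vx; rewrite axV /=; apply/andP; split.
    apply: contra (swap_neq (index x (fiber x))) => /eqP ax.
    by rewrite -index_a ?ax.
  rewrite {1}/a fiber_a // index_a // swapK; apply/eqP.
  by rewrite nth_index // mem_fiber Vx eqxx.
exists (restrict V a); first exact: restrict_matchings.
by move=> x Vx; rewrite restrictE //; case: (aP x Vx).
Qed.

Definition edge_reps a V := [set x in V | enum_rank x < enum_rank (a x)].

Lemma edge_reps_sub a V : edge_reps a V \subset V.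
Proof. by apply/subsetP => x; rewrite inE => /andP[]. Qed.

Lemma matching_inj a V : matching a V -> {in V &, injective a}.
Proof.
move=> aV x y /(matchingP aV)[_ _ aax] /(matchingP aV)[_ _ aay] eq_a.
by rewrite -aax eq_a aay.
Qed.

Lemma mem_edge_reps a V x : matching a V -> x \in V ->
  (a x \in edge_reps a V) = (x \notin edge_reps a V).
Proof.
move=> aV Vx; have [axV axx aax] := matchingP aV Vx; rewrite !inE axV Vx aax /=.
by rewrite -leqNgt [RHS]leq_eqVlt (inj_eq val_inj) (inj_eq enum_rank_inj) (negbTE axx).
Qed.

Lemma edge_reps_cover a V : matching a V -> edge_reps a V :|: a @: edge_reps a V = V.
Proof.
move=> aV; apply/setP => x; rewrite in_setU; apply/orP/idP => [[xV|/imsetP[y yV ->]]|Vx].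
- exact: (subsetP (edge_reps_sub a V)).
- by have [] := matchingP aV (subsetP (edge_reps_sub a V) y yV).
have [_ _ aax] := matchingP aV Vx; case: (boolP (x \in edge_reps a V)) => nx; [by left|right].
by apply/imsetP; exists (a x); rewrite ?aax ?mem_edge_reps.
Qed.

Lemma big_edge_closure (R : Type) (idx : R) (op : Monoid.com_law idx) a V B (F : K -> R) :
  matching a V -> B \subset edge_reps a V ->
  \big[op/idx]_(x in B :|: a @: B) F x = \big[op/idx]_(x in B) op (F x) (F (a x)).
Proof.
move=> aV sB; have sBV := subset_trans sB (edge_reps_sub a V).
have disj : [disjoint B & a @: B].
  apply/pred0P => x /=; apply/negP => /andP[Bx /imsetP[y By ex]].
  have := subsetP sB _ Bx; rewrite ex mem_edge_reps ?(subsetP sBV) //.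
  by rewrite (subsetP sB).
rewrite (eq_bigl [in [predU B & a @: B]]) => [|x]; last by rewrite in_setU.
rewrite bigU //= big_imset ?big_split //=.
by move=> x y Bx By; apply: (matching_inj aV); apply: (subsetP sBV).
Qed.

Lemma big_matching (R : Type) (idx : R) (op : Monoid.com_law idx) a V (F : K -> R) :
  matching a V ->
  \big[op/idx]_(x in V) F x = \big[op/idx]_(x in edge_reps a V) op (F x) (F (a x)).
Proof. by move=> aV; rewrite -{1}(edge_reps_cover aV) (big_edge_closure _ _ aV). Qed.

Lemma card_matching a V : matching a V -> #|V| = #|edge_reps a V|.*2.
Proof.
by move=> aV; rewrite -sum1_card (big_matching _ _ aV) sum_nat_const muln2.
Qed.

Lemma card_stable_subsets a V : matching a V ->
  #|[set W : {set K} | (W \subset V) && stable a W]| <= 2 ^ #|edge_reps a V|.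
Proof.
move=> aV; rewrite -card_powerset; set stables := [set W | _].
have trace_inj : {in stables &, injective (fun W => W :&: edge_reps a V)}.
  have mem_stable W x : W \in stables -> x \in V ->
      (x \in W) = ((if x \in edge_reps a V then x else a x) \in W :&: edge_reps a V).
    rewrite inE in_setI => /andP[sWV aW] Vx; have [_ _ aax] := matchingP aV Vx.
    case: ifP => [->|/negbT]; first by rewrite andbT.
    rewrite -(mem_edge_reps aV Vx) => ->; rewrite andbT.
    by apply/idP/idP => /(stableP aW); rewrite ?aax.
  move=> W W' sW sW' eqWW'; apply/setP => x; case: (boolP (x \in V)) => [Vx|xV].
    by rewrite (mem_stable W) // (mem_stable W') // eqWW'.
  move: sW sW'; rewrite !inE => /andP[/subsetP sW _] /andP[/subsetP sW' _].
  by rewrite (contraNF (sW x)) // (contraNF (sW' x)).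
rewrite -(card_in_imset trace_inj); apply: subset_leq_card; apply/subsetP => _ /imsetP[W _ ->].
by rewrite inE subsetIr.
Qed.

Section StableZeroSums.
Variables (M : zmodType) (rho : K -> M).

Definition stable_zero_sum_free a V :=
  [forall W : {set K}, [&& W \subset V, stable a W & W != set0] ==> ~~ zero_sum rho W].

Lemma stable_zero_sum_freeP a V W : stable_zero_sum_free a V ->
  W \subset V -> stable a W -> zero_sum rho W -> W = set0.
Proof.
move=> /forallP/(_ W)/implyP freeV sWV aW; apply: contraTeq => W0; apply: freeV.
by rewrite sWV aW.
Qed.

Lemma stable_zero_sum_freeS a V W :
  stable_zero_sum_free a V -> W \subset V -> stable_zero_sum_free a W.
Proof.
move=> /forallP freeV sWV; apply/forallP => U; apply/implyP => /and3P[sUW aU U0].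
by have /implyP-> := freeV U; rewrite // aU U0 (subset_trans sUW).
Qed.

Lemma eq_stable_zero_sum_free a b V : {in V, a =1 b} ->
  stable_zero_sum_free a V = stable_zero_sum_free b V.
Proof.
move=> eq_ab; apply: eq_forallb => W; case: (boolP (W \subset V)) => //= sWV.
by rewrite (eq_stable (sub_in1 (subsetP sWV) eq_ab)).
Qed.

Lemma edge_reps_zero_sum_free a V : matching a V -> stable_zero_sum_free a V ->
  zero_sum_free (fun x => rho x + rho (a x))%R (edge_reps a V).
Proof.
move=> aV freeV; apply/zero_sum_freeP => B sB zB; apply/eqP; rewrite -subset0.
suff <- : B :|: a @: B = set0 by apply: subsetUl.
apply: (stable_zero_sum_freeP freeV).
- by rewrite -(edge_reps_cover aV) setUSS ?imsetS.
- apply/forall_inP => x; rewrite !in_setU => /orP[Bx|/imsetP[y By ->]].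
    by rewrite imset_f ?orbT.
  by have [_ _ ->] := matchingP aV (subsetP (subset_trans sB (edge_reps_sub a V)) y By); rewrite By.
- by rewrite /zero_sum (big_edge_closure _ _ aV).
Qed.

End StableZeroSums.

End Matchings.

(** * Alternating paths *)

Section AlternatingPaths.
Variables (K : finType) (Z : {set K}) (a b : K -> K) (z : K).
Hypotheses (aZ : matching a Z) (bZ : matching b Z).
Implicit Types (S W : {set K}) (x y u : K).

(* [S] is a union of alternating cycles of [a] and [b] and of one alternating path with
   ends [x] and [y]; the point [z] may only occur as the end [x]. *)
Definition alternating_path S x y :=
  [&& S \subset Z, stable a S, x \in S, y \in S, x != y,
      stable b (S :\: [set x; y]) & (z \in S) ==> (z == x)].

Lemma alternating_path_sub S x y : alternating_path S x y -> S \subset Z.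
Proof. by case/andP. Qed.

Lemma alternating_path_matching S x y : alternating_path S x y -> matching a S.
Proof. by case/and3P => sS aS _; apply: matching_sub aZ sS aS. Qed.

Lemma alternating_path_left S x y : alternating_path S x y -> x \in S.
Proof. by case/and4P. Qed.

Lemma alternating_path_avoid S x y : alternating_path S x y -> z \notin S :\ x.
Proof.
case/and5P => _ _ _ _ /and3P[_ _ zS].
by apply/negP; rewrite !inE => /andP[+ zS']; move: zS; rewrite zS' => /= ->.
Qed.

Lemma alternating_path_interior S x y : alternating_path S x y ->
  matching b (S :\: [set x; y]).
Proof.
case/and5P => sS _ _ _ /and3P[_ bS _]; apply: matching_sub bZ _ bS.
exact: subset_trans (subsetDl _ _) sS.
Qed.

Lemma alternating_cut_cycle S u : S \subset Z -> stable a S -> stable b S -> u \in S ->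
  (z \in S) ==> (z == u) -> alternating_path S u (b u).
Proof.
move=> sS aS bS Su zS; have bS' := matching_sub bZ sS bS.
have [Sbu buu _] := matchingP bS' Su.
by rewrite /alternating_path sS aS Su Sbu eq_sym buu zS (stableD_edge bS' Su).
Qed.

Lemma alternating_step S x y : alternating_path S x y -> 2 < #|S| ->
  exists x' y', alternating_path (S :\: edge a x) x' y'.
Proof.
move=> pS gtS; have aS := alternating_path_matching pS; have bS := alternating_path_interior pS.
have /and5P[sS _ Sx Sy /and3P[xy _ _]] := pS.
have [Sax axx _] := matchingP aS Sx.
set S' := S :\: _; have sS' : S' \subset Z := subset_trans (subsetDl _ _) sS.
have aS' : stable a S' := stableD_edge aS Sx.
have zS' : z \notin S'.
  by apply: contra (alternating_path_avoid pS); apply/subsetP/setDS; rewrite sub1set !inE eqxx.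
have [ax_y|ax_y] := eqVneq (a x) y.
  have /card_gt0P[u S'u] : 0 < #|S'| by move: gtS; rewrite (cardsD_edge aS Sx).
  exists u, (b u); apply: alternating_cut_cycle; rewrite ?(negbTE zS') //.
  by rewrite /S' /edge ax_y; apply: matching_stable.
have axT : a x \in S :\: [set x; y] by rewrite !inE (negbTE axx) (negbTE ax_y).
have [uT uu _] := matchingP bS axT.
move: (uT); rewrite !inE negb_or => /andP[/andP[ux uy] uS].
exists (b (a x)), y; rewrite /alternating_path sS' aS' (negbTE zS') uy /= andbT.
rewrite !inE negb_or ux uu uS negb_or eq_sym xy eq_sym ax_y Sy /=.
have -> : S' :\: [set b (a x); y] = (S :\: [set x; y]) :\: edge b (a x).
  apply/setP => v; rewrite !inE.
  by case: (v == x) (v == y) (v == a x) (v == b (a x)) (v \in S) => [] [] [] [] [].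
exact: stableD_edge.
Qed.

Lemma alternating_shrink S x y m : alternating_path S x y -> 0 < m -> m.*2 <= #|S| ->
  exists S' x' y', [/\ alternating_path S' x' y', #|S'| = m.*2 &
    S' :\: edge a x' \subset S :\: edge a x].
Proof.
elim: {S}_.+1 {-2}S (ltnSn #|S|) x y => // l IH S ltS x y pS m0 leS.
have [eS|neS] := eqVneq #|S| m.*2; first by exists S, x, y.
have aS := alternating_path_matching pS; have Sx := alternating_path_left pS.
have cS := cardsD_edge aS Sx.
have leS' : m.*2 <= #|S :\: edge a x|.
  by have := card_matching aS; have := card_matching (matchingD_edge aS Sx); lia.
have [|x' [y' pS']] := alternating_step pS; first by lia.
have [|S2 [x2 [y2 [pS2 cS2 sS2]]]] := IH (S :\: edge a x) _ x' y' pS' m0 leS'; first by lia.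
by exists S2, x2, y2; split=> //; apply: subset_trans sS2 (subsetDl _ _).
Qed.

(* For a smallest [S] with dependent edges, removing the edge at [x] leaves independent
   edges, so every dependent set of edges contains the one at [x]. *)
Lemma alternating_critical (M : zmodType) (rho : K -> M) : z \in Z ->
  (forall W, W \subset Z -> stable a W -> W != set0 -> zero_sum rho W -> 2 < #|W|) ->
  ~~ stable_zero_sum_free rho a Z ->
  exists S x y W,
    [/\ alternating_path S x y, 2 < #|S|, stable_zero_sum_free rho a (S :\: edge a x) &
        [/\ W \subset S, stable a W, x \in W & zero_sum rho W]].
Proof.
move=> Zz gt2 depZ.
pose dependent (s : {set K} * K * K) :=
  alternating_path s.1.1 s.1.2 s.2 && ~~ stable_zero_sum_free rho a s.1.1.
have depP : dependent (Z, z, b z).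
  by rewrite /dependent alternating_cut_cycle ?matching_stable ?eqxx ?implybT.
case: (@arg_minnP _ _ dependent (fun s => #|s.1.1|) depP) => -[[S x] y] /andP[/= pS depS] minS.
have aS := alternating_path_matching pS; have Sx := alternating_path_left pS.
move: (depS); rewrite negb_forall => /existsP[W]; rewrite negb_imply negbK.
move=> /andP[/and3P[sW aW W0] zW]; have sWZ := subset_trans sW (alternating_path_sub pS).
have S2 : 2 < #|S| by apply: leq_trans (gt2 W sWZ aW W0 zW) (subset_leq_card sW).
have freeS : stable_zero_sum_free rho a (S :\: edge a x).
  apply: contraT => depS'; have [x' [y' pS']] := alternating_step pS S2.
  have := minS (S :\: edge a x, x', y'); rewrite /dependent /= pS' depS' => /(_ isT).
  by rewrite (cardsD_edge aS Sx) => /ltnW; rewrite ltnn.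
exists S, x, y, W; split=> //; split=> //; apply: contraNT W0 => xW.
apply/eqP/(stable_zero_sum_freeP freeS) => //; apply/subsetP => u Wu.
rewrite !inE (subsetP sW) // andbT negb_or; apply/andP; split.
  by apply: contraNneq xW => <-.
apply: contraNneq xW => eu; have := stableP aW Wu; rewrite eu.
by have [_ _ ->] := matchingP aS Sx.
Qed.

End AlternatingPaths.

(** * Derived characters *)

Local Open Scope ring_scope.

Lemma odd_card_set (I : finType) (V : {set I}) (P : pred I) :
  odd #|[set x in V | P x]| = \sum_(x in V) P x :> bool.
Proof.
rewrite -sum1_card (big_morph odd oddD (erefl : odd 0 = false)).
rewrite big_mkcond [RHS]big_mkcond; apply: eq_bigr => x _; rewrite inE.
by case: (x \in V) (P x) => [] [].
Qed.

Section DerivedCharacters.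
Variables (k c d : nat).
Hypothesis c_gt0 : (0 < c)%N.
Local Notation derived_tables := {ffun 'I_d.+1 -> {ffun 'I_(c + d) -> {ffun bits k -> bits k}}}.
Local Notation key := (key k c).
Implicit Types (T : derived_tables) (x y : key) (V W : {set key}) (a : key -> key).

Definition derived_char T x p : bits k := derived_next T x p (derived_prefix T x p).

Lemma derived_prefixE T x l : derived_prefix T x l = mkseq (derived_char T x) l.
Proof. by elim: l => // l IH; rewrite mkseqS /= IH /derived_char IH. Qed.

(* Level [i] is the position [c.-1 + i]: its character is computed with the table [T i]
   from the characters at lower levels. *)
Definition level_char T i x := derived_char T x (c.-1 + i).

(* The indicator of the position characters strictly below level [i]. *)
Definition level_row T i x : {ffun 'I_(c + d) * bits k -> bool} :=
  [ffun pa : 'I_(c + d) * bits k => (pa.1 < c.-1 + i)%N && (derived_char T x pa.1 == pa.2)].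

Definition level_offset i x : bits k := if i is 0 then keyn x c.-1 else 0.

Lemma lookup_row (M : zmodType) (U : {ffun 'I_(c + d) -> {ffun bits k -> M}}) T i x :
  lookup U (level_row T i x) = \sum_(p < c + d | (p < c.-1 + i)%N) U p (derived_char T x p).
Proof.
transitivity (\sum_p \sum_b U p b *+ level_row T i x (p, b)).
  by rewrite pair_bigA; apply: eq_bigr => -[p b].
rewrite [RHS]big_mkcond; apply: eq_bigr => p _.
rewrite (bigD1 (derived_char T x p)) //= ffunE eqxx andbT big1 => [|b /negPf nb].
  by rewrite addr0 mulrb.
by rewrite ffunE /= eq_sym nb andbF.
Qed.

Lemma derived_char_low T x p : (p < c.-1)%N -> derived_char T x p = keyn x p.
Proof. by move=> pc; rewrite /derived_char /derived_next pc. Qed.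

Lemma level_charE T i x : (i <= d)%N ->
  level_char T i x = level_offset i x + lookup (T (inord i)) (level_row T i x).
Proof.
move=> le_id; rewrite lookup_row /level_char {1}/derived_char /derived_next derived_prefixE.
have tabE j : tab (T j) (mkseq (derived_char T x) (c.-1 + i)) =
    \sum_(p < c + d | (p < c.-1 + i)%N) T j p (derived_char T x p).
  rewrite /tab size_mkseq; apply: eq_bigr => p pi.
  by rewrite nth_mkseq.
rewrite !tabE ltnNge leq_addr /=; case: i le_id tabE => [|i] le_id _; first by rewrite addn0 eqxx.
rewrite -[X in _ == X]addn0 eqn_add2l add0r /=.
by rewrite (_ : (c.-1 + i.+1 - c).+1 = i.+1) //; lia.
Qed.

Definition agree_below i T T' := forall j : 'I_d.+1, (j < i)%N -> T j = T' j.

Lemma derived_char_agree T T' i x p : agree_below i T T' -> (i <= d.+1)%N ->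
  (p < c.-1 + i)%N -> derived_char T x p = derived_char T' x p.
Proof.
move=> eqT le_id; elim/ltn_ind: p => p IH pi.
case: (ltnP p c.-1) => pc; first by rewrite !derived_char_low.
have ep : p = (c.-1 + (p - c.-1))%N by rewrite subnKC.
have jd : (p - c.-1 <= d)%N by lia.
have := level_charE T x jd; have := level_charE T' x jd.
rewrite /level_char !lookup_row -ep => -> ->; congr (_ + _); apply: eq_bigr => q qp.
by rewrite eqT ?inordK //; [rewrite IH //; lia|lia].
Qed.

Lemma level_row_agree T T' i x : agree_below i T T' -> (i <= d.+1)%N ->
  level_row T i x = level_row T' i x.
Proof.
move=> eqT le_id; apply/ffunP => -[p b]; rewrite !ffunE /=.
by case: (ltnP p) => //= pi; rewrite (derived_char_agree x eqT le_id pi).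
Qed.

Lemma zero_sum_agree T T' i V : agree_below i T T' -> (i <= d.+1)%N ->
  zero_sum (level_row T i) V = zero_sum (level_row T' i) V.
Proof.
move=> eqT le_id; congr (_ == 0); apply: eq_bigr => x _.
exact: level_row_agree.
Qed.

Lemma zero_sum_leq T i j V : (j <= i)%N ->
  zero_sum (level_row T i) V -> zero_sum (level_row T j) V.
Proof.
move=> ji /eqP/ffunP z; apply/eqP/ffunP => pa; move: (z pa); rewrite !sum_ffunE ffunE.
case: (ltnP pa.1 (c.-1 + j)) => pj.
  move=> zp; rewrite -[RHS]zp; apply: eq_bigr => x _.
  by rewrite !ffunE pj (leq_trans pj) ?leq_add2l.
by move=> _; rewrite big1 // => x _; rewrite ffunE ltnNge pj.
Qed.

Lemma zero_sum_lookup T i V (M : zmodType) (U : {ffun 'I_(c + d) -> {ffun bits k -> M}}) :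
  exponent_two M -> zero_sum (level_row T i) V ->
  \sum_(x in V) lookup U (level_row T i x) = 0.
Proof.
by move=> M2 /eqP z; rewrite -lookup_sum // z /lookup big1 // => p _; rewrite ffunE.
Qed.

Lemma zero_sum_char T i V (M : zmodType) (g : bits k -> M) p :
  exponent_two M -> zero_sum (level_row T i) V ->
  (p < c + d)%N -> (p < c.-1 + i)%N -> \sum_(x in V) g (derived_char T x p) = 0.
Proof.
move=> M2 z pcd pi; pose q := Ordinal pcd.
rewrite -[RHS](zero_sum_lookup [ffun q' => [ffun b => if q' == q then g b else 0]] M2 z).
apply: eq_bigr => x _; rewrite lookup_row (bigD1 q) //= !ffunE eqxx big1 ?addr0 //.
by move=> q' /andP[_ /negPf nq]; rewrite !ffunE nq.
Qed.

Section ZeroSumLevels.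
Variables (T : derived_tables) (i : nat) (V : {set key}).

Definition matched a W := [forall x in W, level_char T i (a x) == level_char T i x].

Lemma matchedP a W x : matched a W -> x \in W -> level_char T i (a x) = level_char T i x.
Proof. by move=> /forall_inP/(_ x) h /h/eqP. Qed.

Lemma matched_sub a W W' : matched a W -> W' \subset W -> matched a W'.
Proof.
by move=> aW sW; apply/forall_inP => x W'x; rewrite (matchedP aW (subsetP sW _ W'x)).
Qed.

Lemma eq_matched a b W : {in W, a =1 b} -> matched a W = matched b W.
Proof. by move=> eq_ab; rewrite /matched; apply: eq_forallb_in => x Wx; rewrite eq_ab. Qed.

Lemma zero_sum_matched a : matching a V -> matched a V ->
  zero_sum (level_row T i) V -> zero_sum (level_row T i.+1) V.
Proof.
move=> aV ma /eqP/ffunP z; apply/eqP/ffunP => -[p b]; have := z (p, b).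
rewrite !sum_ffunE !ffunE; case: (ltngtP p (c.-1 + i)) => pi.
- move=> zp; rewrite -[RHS]zp; apply: eq_bigr => x _.
  by rewrite !ffunE /= pi addnS ltnS ltnW.
- by move=> _; rewrite big1 // => x _; rewrite ffunE /= addnS ltnS leqNgt pi.
move=> _; rewrite (big_matching _ _ aV) big1 // => x Vx.
rewrite !ffunE /= pi addnS ltnS leqnn /=.
have /(matchedP ma) : x \in V by apply: subsetP Vx; apply: edge_reps_sub.
by rewrite /level_char => ->; case: (_ == _).
Qed.

Hypothesis zV : zero_sum (level_row T i.+1) V.

Lemma zero_sum_matching : (i <= d)%N -> exists2 a, a \in matchings V & matched a V.
Proof.
move=> le_id; have [|a aV fa] := @even_fibers_matching _ _ (level_char T i) V.
  move=> t; rewrite odd_card_set.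
  by rewrite (zero_sum_char (fun b : bits k => b == t) _ zV) //; [exact: exponent_two_bool|lia|lia].
by exists a => //; apply/forall_inP => x /fa ->.
Qed.

Lemma zero_sum_keys : \sum_(x in V) x = 0.
Proof.
have keynE (x : key) (p : 'I_c) : keyn x p = x p by rewrite /keyn valK.
apply/ffunP => p; rewrite sum_ffunE ffunE; case: (ltnP p c.-1) => pc.
  rewrite -[RHS](zero_sum_char id (@exponent_two_bits k) zV (p := p)); try lia.
  by apply: eq_bigr => x _; rewrite derived_char_low // keynE.
have ep : c.-1 = p by have := ltn_ord p; lia.
have charE x : derived_char T x c.-1 = x p + lookup (T (inord 0)) (level_row T 0 x).
  by have := level_charE T x (leq0n d); rewrite /level_char addn0 /= ep keynE.
have := zero_sum_char id (@exponent_two_bits k) zV (p := c.-1).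
rewrite /= (eq_bigr _ (fun x _ => charE x)) big_split /=.
rewrite zero_sum_lookup ?addr0; [apply; lia|exact: exponent_two_bits|exact: zero_sum_leq zV].
Qed.

Lemma zero_sum_last x : x \in V -> x = \sum_(y in V :\ x) y.
Proof.
move=> Vx; apply/eqP; rewrite -exponent_two_addr_eq0 -?big_setD1 ?zero_sum_keys //.
exact: exponent_two_key.
Qed.

Lemma zero_sum_even : ~~ odd #|V|.
Proof.
rewrite -(_ : #|[set x in V | true]| = #|V|); last by apply: eq_card => x; rewrite inE andbT.
rewrite odd_card_set (zero_sum_char (p := 0) (fun=> true) exponent_two_bool zV) //.
  by rewrite addn_gt0 c_gt0.
by rewrite addnS.
Qed.

Lemma zero_sum_card : V != set0 -> exists v, #|V| = v.+2.*2.
Proof.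
have := odd_double_half #|V|; rewrite (negbTE zero_sum_even) -card_gt0.
case: (#|V|./2) => [|[|v]] eV; rewrite -eV //; last by exists v.
have /eqP/cards2P[x [y [xy eVxy]]] : #|V| = 2%N by rewrite -eV.
have := zero_sum_keys; rewrite eVxy big_setU1 ?inE // big_set1 => /eqP.
by rewrite exponent_two_addr_eq0 ?(negbTE xy) //; apply: exponent_two_key.
Qed.

End ZeroSumLevels.

Lemma level_row_inj T i : injective (level_row T i.+1).
Proof.
move=> x y exy; apply: contraTeq isT => xy.
have zxy : zero_sum (level_row T i.+1) [set x; y].
  rewrite /zero_sum big_setU1 ?inE // big_set1 exy.
  exact/eqP/(exponent_two_ffun exponent_two_bool).
have [|v] := zero_sum_card zxy; first by apply/set0Pn; exists x; rewrite !inE eqxx.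
by rewrite cards2 xy !doubleS.
Qed.

End DerivedCharacters.

(** * Resampling the tables of one level *)

Lemma card_bits n : #|{: bits n}| = (2 ^ n)%N.
Proof. by rewrite card_ffun card_bool card_ord. Qed.

Lemma card_bits_gt0 n : 0 < #|{: bits n}|%:R :> rat.
Proof. by rewrite ltr0n card_bits expn_gt0. Qed.

Section Levels.
Variables (k r c d : nat).
Hypothesis c_gt0 : (0 < c)%N.
Local Notation Om := (tables k r c d).
Local Notation table := {ffun 'I_(c + d) -> {ffun bits k -> bits k}}.
Local Notation key := (key k c).
Local Notation n := #|{: bits k}|.
Implicit Types (x y : key) (V W : {set key}) (a : key -> key) (w : Om).

Definition determined_below i (E : pred Om) :=
  forall w w', agree_below i w.1 w'.1 -> E w = E w'.

Lemma determined_belowS i j (E : pred Om) : (i <= j)%N ->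
  determined_below i E -> determined_below j E.
Proof.
by move=> ij detE w w' eqT; apply: detE => l li; apply: eqT; apply: leq_trans ij.
Qed.

Lemma determined_belowI i (E F : pred Om) : determined_below i E -> determined_below i F ->
  determined_below i (fun w => E w && F w).
Proof. by move=> detE detF w w' eqT; rewrite (detE _ _ eqT) (detF _ _ eqT). Qed.

Lemma determined_below_stable_zero_sum_free i a V : (i <= d.+1)%N ->
  determined_below i (fun w => stable_zero_sum_free (level_row w.1 i) a V).
Proof.
by move=> le_id w w' eqT; apply: eq_forallb => W; rewrite (zero_sum_agree c_gt0 _ eqT).
Qed.

Lemma determined_below_matched i a V : (i <= d)%N ->
  determined_below i.+1 (fun w => matched w.1 i a V).
Proof.
move=> le_id w w' eqT; apply: eq_forallb => x.
by rewrite /level_char !(derived_char_agree c_gt0 _ eqT) // addnS.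
Qed.

Definition shift_level i (U : table) w : Om :=
  ([ffun j => if j == inord i then w.1 j + U else w.1 j], w.2).

Lemma shift_level_inj i U : injective (shift_level i U).
Proof.
move=> [T H] [T' H'] [/ffunP eqT ->]; congr pair; apply/ffunP => j; have := eqT j.
by rewrite !ffunE; case: eqP => // _ /addIr.
Qed.

Lemma agree_shift_level i U w : (i <= d)%N -> agree_below i (shift_level i U w).1 w.1.
Proof.
move=> le_id j ji; rewrite ffunE; case: eqP => // ej.
by move: ji; rewrite ej inordK // ltnn.
Qed.

Lemma level_char_shift i U w x : (i <= d)%N ->
  level_char (shift_level i U w).1 i x = level_char w.1 i x + lookup U (level_row w.1 i x).
Proof.
move=> le_id; rewrite !level_charE //.
rewrite (level_row_agree c_gt0 x (agree_shift_level U w le_id)) 1?ltnW //.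
by rewrite ffunE eqxx lookupDl addrA.
Qed.

Lemma matched_edge_reps T i a V : matching a V -> matched (k := k) (c := c) (d := d) T i a V =
  [forall x in edge_reps a V, level_char T i (a x) == level_char T i x].
Proof.
move=> aV; apply/idP/forall_inP => [ma x Vx|mh].
  by rewrite (matchedP ma) // (subsetP (edge_reps_sub a V)).
apply/forall_inP => x Vx; case: (boolP (x \in edge_reps a V)) => [/mh //|].
rewrite -(mem_edge_reps aV Vx) => /mh; have [_ _ ->] := matchingP aV Vx.
by rewrite eq_sym.
Qed.

(* The edges of a matching without stable zero sum are independent, so their matching
   conditions are independent events of probability [1 / n]. *)
Lemma Pr_matched i (E : pred Om) a V m : (i <= d)%N -> determined_below i E ->
  matching a V -> #|V| = m.*2 ->
  Pr (fun w => [&& E w, stable_zero_sum_free (level_row w.1 i) a V & matched w.1 i a V])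
  <= Pr E / n%:R ^+ m.
Proof.
move=> le_id detE aV cV; pose E' w := E w && stable_zero_sum_free (level_row w.1 i) a V.
have detE' : determined_below i E'.
  by apply: determined_belowI => //; apply: determined_below_stable_zero_sum_free; apply: ltnW.
apply: (@le_trans _ _ (n%:R ^- m * Pr E')); last first.
  rewrite mulrC ler_wpM2r ?invr_ge0 ?exprn_ge0 ?ler0n //.
  by apply: le_Pr => w /andP[].
apply: le_trans (Pr_resample_le (E := E') (C := fun w => matched w.1 i a V)
  (resample := shift_level i) _ (@shift_level_inj i) _ _).
- by apply: le_Pr => w /and3P[Ew freew mw]; rewrite /E' Ew freew.
- by apply/card_gt0P; exists 0.
- by move=> U w; apply: detE'; apply: agree_shift_level.
move=> w /andP[_ freeV].
have -> : m = #|edge_reps a V| by apply: double_inj; rewrite -cV (card_matching aV).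
rewrite -(Pr_lookup_eq (edge_reps_zero_sum_free aV freeV)
  (fun x => level_char w.1 i x - level_char w.1 i (a x))).
apply: le_Pr => U; rewrite matched_edge_reps // => /forall_inP mU; apply/forall_inP => x /mU.
rewrite !level_char_shift // (lookupDr _ _ _ (@exponent_two_bits k)) => /eqP/(canRL (addKr _))->.
by rewrite addrCA (addrCA (lookup U _)) exponent_two_bits addr0 addrC.
Qed.

End Levels.

(** * Selected keys *)

Section SelectedKeys.
Variables (k r c d : nat).
Local Notation Om := (tables k r c d).
Local Notation key := (key k c).
Variables (Q : {set key}) (f : key -> bits r -> {ffun qtype Q -> bits r} -> bool).
Local Notation phash := {ffun qtype Q -> bits r}.
Local Notation R := #|{: bits r}|.
Implicit Types (x y : key) (S : {set key}) (w : Om).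

Definition key_row w := level_row w.1 d.+1.

Definition selecting_values x (phi : phash) := [set v : bits r | f x v phi].

Definition max_selecting x := \max_(phi : phash) #|selecting_values x phi|.

Lemma pfE x : pf f x = (max_selecting x)%:R / R%:R.
Proof. by []. Qed.

Lemma leq_max_selecting x phi : (#|selecting_values x phi| <= max_selecting x)%N.
Proof. exact: (leq_bigmax (F := fun phi => #|selecting_values x phi|)). Qed.

Lemma pf_ge0 x : 0 <= pf f x.
Proof. by rewrite divr_ge0 ?ler0n. Qed.

Lemma muf_ge0 : 0 <= muf f.
Proof. by apply: sumr_ge0 => x _; apply: pf_ge0. Qed.

Lemma prod_pf_ge0 S : 0 <= \prod_(x in S) pf f x.
Proof. by apply: prodr_ge0 => x _; apply: pf_ge0. Qed.

Lemma query_pf_ge1 x : selector f -> x \in Q -> 1 <= pf f x.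
Proof.
move=> f_sel xQ; rewrite pfE ler_pdivlMr ?card_bits_gt0 // mul1r ler_nat.
apply: leq_trans (leq_max_selecting x [ffun=> 0]); apply: subset_leq_card.
by apply/subsetP => v _; rewrite inE f_sel.
Qed.

Definition selecting_hashes S : {set {ffun key -> bits r}} :=
  [set h : {ffun key -> bits r} | (h \in pffun_on (0 : bits r) (mem (S :|: Q)) predT)
     && [forall x in S, f x (h x) [ffun q => h (val q)]]].

(* Given the hash values [phi] of the query keys, the other keys are selected independently. *)
Lemma card_selecting S :
  (#|selecting_hashes S| <= R ^ #|Q| * \prod_(x in S :\: Q) max_selecting x)%N.
Proof.
pose values (phi : phash) x := if insub x is Some q then [set phi q] else selecting_values x phi.
pose selecting_from phi : {set {ffun key -> bits r}} :=
  [set h in pfamily (0 : bits r) (mem (S :|: Q)) (fun x => mem (values phi x))].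
have cover : selecting_hashes S \subset \bigcup_phi selecting_from phi.
  apply/subsetP => h; rewrite inE => /andP[/pffun_onP[supp_h _] /forall_inP sel_h].
  apply/bigcupP; exists [ffun q => h (val q)] => //; rewrite inE.
  apply/pfamilyP; split=> // x; rewrite /values; case: insubP => [q _ <- _|xQ].
    by rewrite inE ffunE.
  by rewrite in_setU (negbTE xQ) orbF inE => /sel_h.
apply: leq_trans (subset_leq_card cover) _.
have <- : #|{: phash}| = (R ^ #|Q|)%N by rewrite -[#|Q|](card_sig (mem Q)) -card_ffun.
rewrite -sum_nat_const.
elim/big_rec2: _ => [|phi s A _ leA]; first by rewrite cards0.
apply: leq_trans (leq_card_setU _ _) _; rewrite leq_add // cardsE card_pfamily.
rewrite foldrE big_map big_enum (big_setID Q) /= setDUl setDv setU0.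
rewrite big1 ?mul1n => [|x]; last first.
  rewrite inE => /andP[_ xQ]; rewrite -[RHS](cards1 (phi (exist _ x xQ))) /values.
  by rewrite (insubT (mem Q) xQ).
apply: leq_prod => x; rewrite inE => /andP[/negbTE xQ _]; rewrite /values insubF //.
exact: leq_max_selecting.
Qed.

Definition shift_hash (U : {ffun 'I_(c + d) -> {ffun bits k -> bits r}}) w : Om := (w.1, w.2 + U).

Lemma shift_hash_inj U : injective (shift_hash U).
Proof. by move=> [T H] [T' H'] [-> /addIr->]. Qed.

Hypothesis c_gt0 : (0 < c)%N.

Lemma derived_keyE w x p : derived_key w x p = derived_char w.1 x p.
Proof. by rewrite ffunE derived_prefixE nth_mkseq. Qed.

Lemma tornadoE w x : tornado w x = lookup w.2 (key_row w x).
Proof.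
rewrite lookup_row; apply: eq_big => [p|p _]; last by rewrite derived_keyE.
by have := ltn_ord p; lia.
Qed.

Lemma tornado_shift U w x : tornado (shift_hash U w) x = tornado w x + lookup U (key_row w x).
Proof. by rewrite !tornadoE lookupDl. Qed.

Lemma Pr_selected_shift w S : zero_sum_free (key_row w) (S :|: Q) ->
  Pr (fun U => S \subset selected f (shift_hash U w)) <= \prod_(x in S :\: Q) pf f x.
Proof.
move=> freeSQ; set A := S :|: Q.
pose hashes (h : key -> bits r) (U : {ffun 'I_(c + d) -> {ffun bits k -> bits r}}) :=
  [forall x in A, lookup U (key_row w x) == h x - tornado w x].
apply: (le_trans (union_bound (P := [in selecting_hashes S]) (F := hashes) _)).
  move=> U /subsetP sel_U; pose h := [ffun x => if x \in A then tornado (shift_hash U w) x else 0].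
  have hA x : x \in A -> h x = tornado (shift_hash U w) x by rewrite ffunE => ->.
  exists h; last by apply/forall_inP => x Ax; rewrite hA // tornado_shift addrC addKr.
  rewrite inE; apply/andP; split.
    apply/pffun_onP; split=> //; apply/subsetP => x.
    by rewrite inE ffunE; case: ifP; rewrite ?eqxx.
  apply/forall_inP => x Sx; rewrite hA ?inE ?Sx //.
  have := sel_U x Sx; rewrite inE; congr f; apply/ffunP => q.
  by rewrite !ffunE in_setU (valP q) orbT.
rewrite (eq_bigr (fun=> R%:R ^- #|A|)) => [|h _]; last exact: Pr_lookup_eq.
have -> : #|A| = (#|Q| + #|S :\: Q|)%N.
  by rewrite /A setUC cardsU cardsD [Q :&: S]setIC addnBA ?subset_leq_card ?subsetIl.
have pf_prod : \prod_(x in S :\: Q) pf f x =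
    (\prod_(x in S :\: Q) max_selecting x)%N%:R / R%:R ^+ #|S :\: Q|.
  by rewrite prodf_div natr_prod prodr_const.
rewrite sumr_const pf_prod exprD invfM -[leLHS]mulr_natr mulrAC.
rewrite ler_wpM2r ?invr_ge0 ?exprn_ge0 ?ler0n //.
rewrite ler_pdivrMl ?exprn_gt0 ?card_bits_gt0 // -natrX -natrM ler_nat.
exact: card_selecting.
Qed.

Hypothesis f_sel : selector f.

Lemma prod_pf_query S : S \subset Q -> 1 <= \prod_(x in S) pf f x.
Proof.
move=> sSQ; apply: (big_ind (fun u : rat => 1 <= u)) => // [u v|x xS]; first exact: mulr_ege1.
by rewrite query_pf_ge1 // (subsetP sSQ).
Qed.

Lemma Pr_selected (E : pred Om) S : (forall w w', w.1 = w'.1 -> E w = E w') ->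
  Pr (fun w => [&& E w, S \subset selected f w &
                 (S \subset Q) || zero_sum_free (key_row w) (S :|: Q)])
  <= (\prod_(x in S) pf f x) * Pr E.
Proof.
move=> detE; have [sSQ|nsSQ] := boolP (S \subset Q).
  apply: (@le_trans _ _ (Pr E)); first by apply: le_Pr => w /andP[].
  by rewrite ler_peMl ?Pr_ge0 ?prod_pf_query.
pose E' w := E w && zero_sum_free (key_row w) (S :|: Q).
have detE' U w : E' (shift_hash U w) = E' w by rewrite /E' (detE _ w).
apply: (@le_trans _ _ ((\prod_(x in S :\: Q) pf f x) * Pr E')).
  apply: le_trans (Pr_resample_le (E := E') (C := fun w => S \subset selected f w) _
    shift_hash_inj detE' _).
  - by apply: le_Pr => w /and3P[Ew sel_w free_w]; rewrite /E' Ew sel_w andbT.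
  - by apply/card_gt0P; exists 0.
  - by move=> w /andP[_]; apply: Pr_selected_shift.
apply: ler_pM; rewrite ?prod_pf_ge0 ?Pr_ge0 //; last by apply: le_Pr => w /andP[].
by rewrite [leRHS](big_setID Q) /= ler_peMl ?prod_pf_ge0 ?prod_pf_query ?subsetIr.
Qed.

End SelectedKeys.

(** * Numerical estimates *)

Local Close Scope ring_scope.

Lemma bin_odd_fact m i :
  'C(m.*2.+1, i.*2.+1) * odd_fact i.+1 = m.*2.+1 * 'C(m, i) * \prod_(j < i) (m - j).*2.-1.
Proof.
elim: i => [|i IH]; first by rewrite odd_factS /odd_fact !big_ord0 double0 bin0 bin1 !muln1.
have [mi|im] := leqP m i; first by rewrite !bin_small ?mul0n ?muln0 //; lia.
apply/eqP; rewrite -(eqn_pmul2l (ltn0Sn i)) -(eqn_pmul2l (isT : 0 < 2)); apply/eqP.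
have bin_even := mul_bin_left m.*2.+1 i.*2.+1; have bin_odd := mul_bin_left m.*2.+1 i.*2.+2.
have bin_m := mul_bin_left m i.
rewrite (_ : m.*2.+1 - i.*2.+1 = 2 * (m - i)) in bin_even; last by lia.
rewrite (_ : m.*2.+1 - i.*2.+2 = (m - i).*2.-1) in bin_odd; last by lia.
rewrite odd_factS big_ord_recr doubleS /=.
transitivity ((i.*2.+3 * 'C(m.*2.+1, i.*2.+3)) * i.*2.+2 * odd_fact i.+1); first by lia.
rewrite bin_odd.
transitivity ((i.*2.+2 * 'C(m.*2.+1, i.*2.+2)) * (m - i).*2.-1 * odd_fact i.+1); first by lia.
rewrite bin_even.
transitivity (2 * (m - i) * (m - i).*2.-1 * ('C(m.*2.+1, i.*2.+1) * odd_fact i.+1)); first by lia.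
rewrite IH.
transitivity (2 * ((m - i) * 'C(m, i)) * m.*2.+1 * (m - i).*2.-1 * \prod_(j < i) (m - j).*2.-1).
  by lia.
rewrite -bin_m; move: (\prod_(_ < _) _) (m - i).*2.-1 => P e; lia.
Qed.

Lemma bin_odd_fact_le M j :
  'C(M.*2 + 3, j.*2 + 3) * odd_fact j.+2
  <= (M.*2 + 3) * (M.*2 + 1) * ('C(M.+1, j.+1) * (M.*2 - 1) ^ j).
Proof.
rewrite (_ : M.*2 + 3 = M.+1.*2.+1); last by lia.
rewrite (_ : j.*2 + 3 = j.+1.*2.+1) ?bin_odd_fact; last by lia.
rewrite -!mulnA leq_mul2l /= mulnCA leq_mul2l big_ord_recl subn0 leq_mul ?orbT //; first by lia.
rewrite -[X in _ ^ X](card_ord j) -prod_nat_const leq_prod // => l _.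
by rewrite lift0; lia.
Qed.

Local Open Scope ring_scope.

(* The index [M] stands for circuits of [2M + 4] keys. The values are chosen so that
   [circuit_weight_sum_le] holds, with a growth below [4 ^+ M] for [matching_ratio_sum_le]. *)
Definition circuit_weight M : rat := if M is 0 then 1 else 5 * 3 ^+ M.

Lemma circuit_weight_ge1 M : 1 <= circuit_weight M.
Proof.
case: M => [|M]; first exact: lexx.
have : (1 : rat) <= 3 ^+ M.+1 by apply: exprn_ege1.
rewrite /circuit_weight; lra.
Qed.

Lemma circuit_weight_le M : circuit_weight M <= 5 * 3 ^+ M.
Proof. by case: M => [|M]; [rewrite expr0 /circuit_weight; lra|exact: lexx]. Qed.

Definition binomial_quotient (R : numDomainType) N (z : R) := \sum_(j < N) 'C(N, j.+1)%:R * z ^+ j.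

Lemma binomial_quotientE (R : numDomainType) N (z : R) :
  z * binomial_quotient N z = (1 + z) ^+ N - 1.
Proof.
rewrite exprDn big_ord_recl /= bin0 subn0 expr1n expr0 !mulr1 mulr1n addrC addKr.
rewrite mulr_sumr; apply: eq_bigr => j _.
by rewrite expr1n mul1r /bump /= mulrCA -exprS mulr_natl.
Qed.

Lemma binomial_quotient_mono (R : numDomainType) N (z z' : R) : 0 <= z -> z <= z' ->
  binomial_quotient N z <= binomial_quotient N z'.
Proof.
move=> z0 zz'; apply: ler_sum => j _; rewrite ler_wpM2l ?ler0n //.
by rewrite lerXn2r ?nnegrE // (le_trans z0).
Qed.

Definition circuit_coef M j : rat := ('C(M.*2 + 3, j.*2 + 3) * odd_fact j.+2)%N%:R / 3.

Definition circuit_estimate n M : rat := (M.*2 + 3)%:R * (M.*2 + 1)%:R / 3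
  * (5 * binomial_quotient M.+1 (3 * (M.*2 - 1)%N%:R / n%:R) - 4 * M.+1%:R).

Lemma sum_circuit_coef_le n M :
  \sum_(j < M.+1) circuit_coef M j * circuit_weight j / n%:R ^+ j
  <= circuit_estimate n M.
Proof.
rewrite /circuit_estimate; set A := _%:R * _%:R / 3; set z := 3 * _ / _.
have term j : circuit_coef M j * (3 / n%:R) ^+ j <= A * ('C(M.+1, j.+1)%:R * z ^+ j).
  have := bin_odd_fact_le M j; rewrite -(ler_nat rat) => coef_le.
  have s0 : 0 <= (3 / n%:R) ^+ j / 3 :> rat by rewrite divr_ge0 ?exprn_ge0 ?divr_ge0 ?ler0n.
  have := ler_wpM2r s0 coef_le; rewrite /circuit_coef /A /z !natrM natrX.
  rewrite [3 * _ / _]mulrAC (exprMn _ (3 / n%:R)); move: (_ ^+ j) (_ ^+ j) => u v; lra.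
rewrite big_ord_recl /binomial_quotient big_ord_recl /=.
have coef0 : circuit_coef M 0 <= A * M.+1%:R by have := term 0; rewrite !expr0 !mulr1 bin1.
rewrite !expr0 !bin1 !mulr1 mulrBr mulrDr mulrDr.
set rest := \sum_(_ < _) _; set rest' := \sum_(_ < _) _.
suff : rest <= A * (5 * rest') by lra.
rewrite /rest /rest' !mulr_sumr; apply: ler_sum => j _; rewrite /bump /= add1n.
have := term j.+1; rewrite expr_div_n; lra.
Qed.

(* The inequality [circuit_estimate n M <= 5 * 3 ^+ M] without denominators, over the
   binary numbers to make its evaluation feasible. *)
Definition circuit_check n M : bool :=
  let m := N.of_nat M in let: (A, p) := ((2 * m + 3) * (2 * m + 1), 6 * m - 3)%num in
  (5 * A * (N.of_nat n + p) ^ (m + 1) <=?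
   p * N.of_nat n ^ m * (15 * 3 ^ m + 4 * A * (m + 1)) + 5 * A * N.of_nat n ^ (m + 1))%num.

Lemma circuit_check_lt100 :
  all (fun M => circuit_check (maxn 256 (32 * (M + 3) %/ 9)) M) (iota 1 99).
Proof. by vm_compute. Qed.

Lemma circuit_checkE n M : circuit_check n M ->
  (5 * ((2 * M + 3) * (2 * M + 1)) * (n + (6 * M - 3)) ^ (M + 1) <=
   (6 * M - 3) * n ^ M * (15 * 3 ^ M + 4 * ((2 * M + 3) * (2 * M + 1)) * (M + 1))
   + 5 * ((2 * M + 3) * (2 * M + 1)) * n ^ (M + 1))%N.
Proof. by rewrite /circuit_check => /N.leb_le; lia. Qed.

Lemma circuit_estimate_check n M : (0 < n)%N -> (0 < M)%N -> circuit_check n M ->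
  circuit_estimate n M <= 5 * 3 ^+ M.
Proof.
move=> n0 M0 /circuit_checkE; rewrite /circuit_estimate -!mul2n.
rewrite (_ : 6 * M - 3 = 3 * (2 * M - 1))%N; last by lia.
have : (0 < 3 * (2 * M - 1))%N by lia.
rewrite -!natrM [(M + 1)%N]addn1; move: ((2 * M + 3) * _)%N (3 * _)%N => A p p0.
rewrite -(ler_nat rat) !(natrM, natrD, natrX); pose z : rat := p%:R / n%:R.
have := binomial_quotientE M.+1 z; set B := binomial_quotient _ _ => zB.
have nR : 0 < n%:R :> rat by rewrite ltr0n.
have nz : n%:R * z = p%:R by rewrite mulrCA divff ?mulr1 // gt_eqF.
have -> : (n%:R + p%:R) ^+ M.+1 = n%:R ^+ M.+1 + p%:R * n%:R ^+ M * B.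
  have -> : n%:R + p%:R = n%:R * (1 + z) by rewrite mulrDr mulr1 nz.
  by rewrite exprMn -[(1 + z) ^+ _](subrK 1) -zB -nz exprS; ring.
have c0 : 0 < p%:R * n%:R ^+ M :> rat by rewrite mulr_gt0 ?exprn_gt0 ?ltr0n.
move: (p%:R * n%:R ^+ M) (n%:R ^+ M.+1) (3 ^+ M : rat) (A%:R : rat) c0 => u v t a u0 check_le.
rewrite -(ler_pM2l u0); lra.
Qed.

Lemma geometric_beats_quadratic M : (100 <= M)%N ->
  (M.*2 + 3)%:R * (M.*2 + 1)%:R * (43 / 81) <= (48 / 43) ^+ M :> rat.
Proof.
elim: M => // M IH; rewrite leq_eqVlt => /orP[/eqP <-|lt].
  rewrite -[100.*2]/200%N !natrD; lra.
have {}IH := IH lt; rewrite exprS.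
apply: (@le_trans _ _ (48 / 43 * ((M.*2 + 3)%:R * (M.*2 + 1)%:R * (43 / 81)))); last first.
  by apply: ler_wpM2l IH; lra.
rewrite -!mul2n !natrD !natrM -[M.+1%:R]natr1.
have : 100 <= M%:R :> rat by rewrite ler_nat.
move: (M%:R) => m m100; have c0 : 0 <= (2 * m + 3) * (43 / 81) by lra.
have ratio : 2 * (m + 1) + 3 <= 48 / 43 * (2 * m + 1) by lra.
have := ler_wpM2l c0 ratio; lra.
Qed.

Lemma circuit_estimate_large n M : (100 <= M)%N -> (32 * (M + 3) <= 9 * n)%N ->
  circuit_estimate n M <= 5 * 3 ^+ M.
Proof.
move=> M100 Mn; rewrite /circuit_estimate; set z := _ / n%:R.
have nR : 0 < n%:R :> rat by rewrite ltr0n; lia.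
have z0 : 0 <= z by rewrite divr_ge0 ?mulr_ge0 ?ler0n.
have z_le : z <= 27 / 16.
  have : ((M.*2 - 1) * 16 <= 9 * n)%N by lia.
  by rewrite /z (ler_pdivrMr _ _ nR) -(ler_nat rat) !natrM; lra.
set A := _%:R * _%:R; have A0 : 0 <= A by rewrite mulr_ge0 ?ler0n.
set B := binomial_quotient _ _.
have B_le : 27 / 16 * B <= 43 / 16 * (43 / 16) ^+ M.
  apply: (@le_trans _ _ (27 / 16 * binomial_quotient M.+1 (27 / 16))).
    by apply: ler_wpM2l; [lra|apply: binomial_quotient_mono].
  by rewrite binomial_quotientE -exprS (_ : 1 + 27 / 16 = 43 / 16) ?gerBl //; lra.
have geo := geometric_beats_quadratic M100; rewrite -/A in geo.
have pow43 : (48 / 43) ^+ M * (43 / 16) ^+ M = 3 ^+ M :> rat.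
  by rewrite -exprMn; congr (_ ^+ M); lra.
have p0 : 0 <= (43 / 16) ^+ M :> rat by apply: exprn_ge0; lra.
have M0 : 0 <= M.+1%:R :> rat by rewrite ler0n.
have AB := ler_wpM2l A0 B_le; have := ler_wpM2r p0 geo; rewrite pow43.
have AM : 0 <= A * M.+1%:R by rewrite mulr_ge0.
lra.
Qed.

Lemma circuit_estimate_antitone n n' M : (0 < n')%N -> (n' <= n)%N ->
  circuit_estimate n M <= circuit_estimate n' M.
Proof.
move=> n'0 n'n; have n0 : (0 < n)%N by apply: leq_trans n'n.
have p0 : 0 <= 3 * (M.*2 - 1)%N%:R :> rat by apply: mulr_ge0; apply: ler0n.
apply: ler_wpM2l; first by apply: divr_ge0; [apply: mulr_ge0; apply: ler0n|lra].
apply: (lerB _ (lexx _)); apply: ler_wpM2l; first exact: ler0n.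
apply: binomial_quotient_mono; first by rewrite divr_ge0 ?ler0n.
by apply: (ler_wpM2l p0); rewrite lef_pV2 ?posrE ?ltr0n ?ler_nat.
Qed.

Lemma circuit_weight_sum_le n M : (256 <= n)%N -> (32 * (M + 3) <= 9 * n)%N ->
  \sum_(j < M.+1) circuit_coef M j * circuit_weight j / n%:R ^+ j <= circuit_weight M.
Proof.
move=> n256 Mn; case: (posnP M) => [->|M0].
  rewrite big_ord1 /circuit_coef (_ : 'C(_, _) * _ = 3)%N; first by rewrite /= expr0; lra.
  by rewrite /odd_fact !big_ord_recr big_ord0.
have n0 : (0 < n)%N by apply: leq_trans n256.
apply: le_trans (sum_circuit_coef_le n M) _.
have -> : circuit_weight M = 5 * 3 ^+ M by case: M M0 {Mn}.
case: (ltnP M 100) => M100; last exact: circuit_estimate_large.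
set n' := maxn 256 (32 * (M + 3) %/ 9).
have n'0 : (0 < n')%N by rewrite /n'; lia.
apply: le_trans (circuit_estimate_antitone _ n'0 (_ : n' <= n)%N) _.
  by rewrite geq_max n256 /=; lia.
apply: circuit_estimate_check => //; apply: (allP circuit_check_lt100).
by rewrite mem_iota M0 M100.
Qed.

(* The number of pairs of near-perfect matchings of [2M + 3] keys, over the number of
   orderings of these keys. *)
Definition matching_ratio M : rat := (odd_fact M.+2)%:R ^+ 2 / ((M.*2 + 3)`!)%:R.

Lemma matching_ratio_ge0 M : 0 <= matching_ratio M.
Proof. by rewrite divr_ge0 ?exprn_ge0 ?ler0n. Qed.

Lemma matching_ratio0 : matching_ratio 0 = 3 / 2.
Proof.
rewrite /matching_ratio (_ : odd_fact 2 = 3)%N; last by rewrite /odd_fact !big_ord_recr big_ord0.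
by rewrite (_ : (0.*2 + 3)`! = 6)%N //; lra.
Qed.

Lemma matching_ratioS M : matching_ratio M.+1 * (2 * M%:R + 4) = matching_ratio M * (2 * M%:R + 5).
Proof.
have fact_neq0 m : m`!%:R != 0 :> rat by rewrite pnatr_eq0 -lt0n fact_gt0.
rewrite /matching_ratio odd_factS natrM (_ : M.+1.*2 + 3 = (M.*2 + 3).+2)%N; last by lia.
rewrite !factS !natrM (_ : M.+2.*2.+1 = (M.*2 + 3).+2)%N; last by lia.
rewrite (_ : (M.*2 + 3).+2%:R = 2 * M%:R + 5 :> rat); last by rewrite -mul2n; lra.
rewrite (_ : (M.*2 + 3).+1%:R = 2 * M%:R + 4 :> rat); last by rewrite -mul2n; lra.
have M0 : 0 <= M%:R :> rat by rewrite ler0n.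
move: (odd_fact _) ((_)`!%:R : rat) (fact_neq0 (M.*2 + 3)%N) => a b b0.
move: (M%:R : rat) M0 => m m0.
field; rewrite b0 /=; apply/andP; split; apply/lt0r_neq0; lra.
Qed.

Lemma matching_ratio_le_linear M : matching_ratio M <= M%:R + 2.
Proof.
move: matching_ratio matching_ratio0 matching_ratioS => rho rho0 rhoS.
elim: M => [|M IH]; first by rewrite rho0; lra.
have M0 : 0 <= M%:R :> rat := ler0n _ _; have b0 : 0 < 2 * M%:R + 4 :> rat by lra.
rewrite -(ler_pM2r b0) rhoS -natr1.
have c0 : 0 <= 2 * M%:R + 5 :> rat by lra.
have := ler_wpM2r c0 IH; move: (M%:R : rat) M0 => m m0; nra.
Qed.

Lemma matching_ratio_le_geometric M : matching_ratio M <= 7 / 4 * (9 / 8) ^+ M.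
Proof.
move: matching_ratio matching_ratio_ge0 matching_ratio0 matching_ratioS => rho rho_ge0 rho0 rhoS.
have rho1 := rhoS 0%N; have rho2 := rhoS 1%N; rewrite rho0 in rho1.
elim: M => [|[|[|M]] IH].
- by rewrite rho0 expr0; lra.
- by rewrite expr1; lra.
- by rewrite expr2; lra.
have M0 : 0 <= M%:R :> rat := ler0n _ _; have step := rhoS M.+2.
rewrite -!natr1 in step; rewrite exprS; move: (M%:R : rat) M0 step => m m0 step.
have b0 : 0 < 2 * (m + 1 + 1) + 4 by lra.
have ratio_le : 2 * (m + 1 + 1) + 5 <= 9 / 8 * (2 * (m + 1 + 1) + 4) by lra.
have b1 : 0 <= 9 / 8 * (2 * (m + 1 + 1) + 4) by lra.
rewrite -(ler_pM2r b0) step; have := ler_wpM2l (rho_ge0 M.+2) ratio_le.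
have := ler_wpM2r b1 IH; lra.
Qed.

Lemma geometric_sum_le (R : numFieldType) (q : R) N :
  0 <= q -> q < 1 -> \sum_(j < N) q ^+ j <= (1 - q)^-1.
Proof.
move=> q0 q1; have q1' : 0 < 1 - q by rewrite subr_gt0.
rewrite -[leRHS]mul1r ler_pdivlMr // mulrC -opprB mulNr -subrX1 opprB gerBl.
exact: exprn_ge0.
Qed.

Lemma matching_ratio_sum_le W (x : rat) : 0 <= x -> x <= 1 / 4 ->
  \sum_(M < W) matching_ratio M * (5 * 3 ^+ M) * x ^+ M <= 56.
Proof.
move=> x0 x4; have x3 : 0 <= 3 * x by lra.
have term M : matching_ratio M * (5 * 3 ^+ M) * x ^+ M <= 35 / 4 * (27 / 32) ^+ M.
  rewrite (_ : 27 / 32 = 9 / 8 * (3 / 4)); last by lra.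
  have := ler_pM (matching_ratio_ge0 M) (exprn_ge0 M x3) (matching_ratio_le_geometric M)
    (lerXn2r M x3 (_ : 0 <= 3 / 4) (_ : 3 * x <= 3 / 4)).
  rewrite !exprMn; move: (matching_ratio M) => rho; lra.
apply: (@le_trans _ _ (\sum_(M < W) 35 / 4 * (27 / 32) ^+ M)); first exact: ler_sum.
rewrite -mulr_sumr; have q0 : 0 <= 27 / 32 :> rat by lra.
have q1 : 27 / 32 < 1 :> rat by lra.
have := geometric_sum_le W q0 q1; rewrite (_ : (1 - 27 / 32)^-1 = 32 / 5 :> rat); last by field.
lra.
Qed.

Lemma truncation_estimate_nat m : (0 < m)%N ->
  ((72 * m) * (128 * m) * 2 ^ (128 * m) <= 4 ^ (72 * m - 1))%N.
Proof.
move=> m0; have m_le : (m <= 2 ^ m.-1)%N by have := ltn_expl m.-1 (ltnSn 1); rewrite prednK.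
have -> : (4 ^ (72 * m - 1) = 2 ^ (2 * (72 * m - 1)))%N by rewrite expnM.
have -> : (2 * (72 * m - 1) = 14 + m.-1 + m.-1 + 128 * m + 14 * m.-1)%N by lia.
have square_le : ((72 * m) * (128 * m) <= 2 ^ (14 + m.-1 + m.-1))%N.
  rewrite !expnD; move: (2 ^ m.-1)%N m_le => e m_le.
  by apply: (@leq_trans (2 ^ 14 * m * m)%N); [lia|rewrite !leq_mul].
rewrite expnD expnD; apply: leq_trans (leq_mul square_le (leqnn _)) (leq_pmulr _ _).
by rewrite expn_gt0.
Qed.

Lemma truncation_estimate m : (0 < m)%N ->
  (72 * m)%N%:R * (1 / 4) ^+ (72 * m - 1) * (128 * m)%N%:R <= 1 / (2 ^ (128 * m))%N%:R :> rat.
Proof.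
move/truncation_estimate_nat; move: (72 * m)%N (128 * m)%N (72 * m - 1)%N => a b e.
rewrite -(ler_nat rat) !natrM !natrX expr_div_n expr1n => nat_le.
rewrite ler_pdivlMr ?exprn_gt0 //; have p0 : 0 < 4 ^+ e :> rat by rewrite exprn_gt0.
have -> : a%:R * (1 / 4 ^+ e) * b%:R * 2 ^+ b = a%:R * b%:R * 2 ^+ b / 4 ^+ e :> rat by ring.
by rewrite ler_pdivrMr // mul1r.
Qed.

(** * Circuits at the lower levels *)

Lemma sum_subsets_le (R : numDomainType) (K : finType) (S : {set K}) (size_of : nat -> nat) N
    (F : {set K} -> R) (h : nat -> R) :
  (forall j, size_of j <= #|S| -> j < N)%N -> (forall j, 0 <= h j) ->
  (forall U : {set K}, U \subset S -> F U != 0 -> exists2 j, #|U| = size_of j & F U <= h j) ->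
  \sum_(U : {set K} | U \subset S) F U <= \sum_(j < N) 'C(#|S|, size_of j)%:R * h j.
Proof.
move=> size_lt h0 Fh; pose by_size (U : {set K}) := \sum_(j < N) (#|U| == size_of j)%:R * h j.
have F_le (U : {set K}) : U \subset S -> F U <= by_size U.
  have terms0 (P : pred 'I_N) : 0 <= \sum_(j < N | P j) (#|U| == size_of j)%:R * h j.
    by apply: sumr_ge0 => j _; rewrite mulr_ge0 ?ler0n.
  move=> sU; have [->|/(Fh U sU)[j cU F_le_h]] := eqVneq (F U) 0; first exact: terms0.
  have jN : (j < N)%N by rewrite size_lt // -cU subset_leq_card.
  by rewrite /by_size (bigD1 (Ordinal jN)) //= cU eqxx mul1r -cU ler_wpDr.
apply: le_trans (ler_sum _ F_le) _; rewrite exchange_big /=.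
apply: ler_sum => j _; rewrite -mulr_suml -natr_sum -cards_draws -sum1_card ler_wpM2r //.
rewrite ler_nat big_mkcond [leqRHS]big_mkcond /=; apply: leq_sum => U _.
by rewrite inE; case: (U \subset S) => //=; case: (_ == _).
Qed.

Lemma cardsD1_double (K : finType) (S : {set K}) M x :
  #|S| = M.+2.*2 -> x \in S -> #|S :\ x| = (M.*2 + 3)%N.
Proof. by rewrite (cardsD1 x) => + Sx; rewrite Sx; lia. Qed.

Lemma cardsD1_odd (K : finType) (S : {set K}) M x :
  #|S| = (M.*2 + 3)%N -> x \in S -> #|S :\ x| = M.+1.*2.
Proof. by rewrite (cardsD1 x) => + Sx; rewrite Sx; lia. Qed.

Section Circuits.
Variables (k r c d : nat).
Local Notation n := #|{: bits k}|.
Hypotheses (n_ge256 : (256 <= n)%N) (c_gt0 : (0 < c)%N).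
Local Notation Om := (tables k r c d).
Local Notation key := (key k c).
Implicit Types (x y : key) (S U V W : {set key}) (w : Om).

Definition level_circuit i V w := circuit (level_row w.1 i.+1) V.

Lemma level_circuit_card i V w : level_circuit i V w -> exists M, #|V| = M.+2.*2.
Proof. by case/and3P => V0 zV _; exact: (zero_sum_card c_gt0 zV V0). Qed.

Lemma level_circuit_last i V w x : level_circuit i V w -> x \in V -> x = \sum_(y in V :\ x) y.
Proof. by case/and3P => _ zV _; exact: (zero_sum_last c_gt0 zV). Qed.

Lemma determined_below_circuit i V : (i <= d)%N -> determined_below i.+1 (level_circuit i V).
Proof.
move=> le_id w w' eqT; rewrite /level_circuit /circuit.
rewrite (zero_sum_agree c_gt0 _ eqT le_id); congr [&& _, _ & _]; apply: eq_forallb => W.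
by rewrite (zero_sum_agree c_gt0 _ eqT le_id).
Qed.

Lemma level_circuit_matching i V w x : (i <= d)%N -> level_circuit i V w -> x \in V ->
  exists2 a, a \in matchings V &
    stable_zero_sum_free (level_row w.1 i) a (V :\: edge a x)
      && matched w.1 i a (V :\: edge a x).
Proof.
move=> le_id cV Vx; have /and3P[_ zV _] := cV.
have [a aV ma] := zero_sum_matching c_gt0 zV le_id; exists a => //.
rewrite (matched_sub ma (subsetDl _ _)) andbT.
apply/forallP => W; apply/implyP => /and3P[sW aW W0]; apply/negP => zW.
have sWV : W \subset V := subset_trans sW (subsetDl _ _).
have fW := matching_sub (matchings_matching aV) sWV aW.
have eWV := circuit_min cV sWV W0 (zero_sum_matched fW (matched_sub ma sWV) zW).
by have := subsetP sW x; rewrite eWV Vx !inE eqxx => /(_ isT).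
Qed.

Lemma Pr_level_circuit_step i V M (E : pred Om) : (i <= d)%N -> determined_below i E ->
  (forall w, level_circuit i V w -> E w) -> #|V| = M.+2.*2 ->
  Pr (level_circuit i V) <= (odd_fact M.+2)%:R / n%:R ^+ M.+1 * Pr E.
Proof.
move=> le_id detE circuitE cV; have /card_gt0P[x Vx] : (0 < #|V|)%N by rewrite cV.
pose V' (a : key -> key) := V :\: edge a x.
pose F (a : {ffun key -> key}) w :=
  [&& E w, stable_zero_sum_free (level_row w.1 i) a (V' a) & matched w.1 i a (V' a)].
apply: (le_trans (union_bound (P := [in matchings V]) (F := F) _)).
  move=> w cVw; have [a aV edges] := level_circuit_matching le_id cVw Vx.
  by exists a; rewrite // /F circuitE.
apply: (@le_trans _ _ (\sum_(a in matchings V) Pr E / n%:R ^+ M.+1)).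
  apply: ler_sum => a /matchings_matching aV; apply: (Pr_matched c_gt0 le_id detE).
    exact: matchingD_edge.
  by move: cV; rewrite (cardsD_edge aV Vx) doubleS => -[].
rewrite sumr_const -[leLHS]mulr_natl [leRHS]mulrAC -[leRHS]mulrA.
by rewrite ler_wpM2r ?mulr_ge0 ?invr_ge0 ?exprn_ge0 ?Pr_ge0 ?ler0n // ler_nat card_matchings.
Qed.

Definition circuit_bound M i : rat :=
  (odd_fact M.+2)%:R / 3 / n%:R ^+ M * circuit_weight M * (3 / n%:R) ^+ i.+1.

Lemma circuit_bound_ge0 M i : 0 <= circuit_bound M i.
Proof.
have w0 : 0 <= circuit_weight M by apply: le_trans (circuit_weight_ge1 M).
by rewrite /circuit_bound !mulr_ge0 ?invr_ge0 ?exprn_ge0 ?divr_ge0 ?ler0n.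
Qed.

Lemma circuit_bound_step M i :
  (odd_fact M.+2)%:R / n%:R ^+ M.+1 * (circuit_weight M * (3 / n%:R) ^+ i) = circuit_bound M i.
Proof.
have n0 : n%:R != 0 :> rat by rewrite gt_eqF // card_bits_gt0.
rewrite /circuit_bound !exprS; have A0 : n%:R ^+ M != 0 :> rat by rewrite expf_neq0.
by move: (_ ^+ i) => B; field; rewrite A0 n0.
Qed.

Definition on_circuit i S x w :=
  [exists U : {set key}, (U \subset S) && level_circuit i (x |: U) w].

Lemma determined_below_on_circuit i S x : (i <= d)%N -> determined_below i.+1 (on_circuit i S x).
Proof.
move=> le_id w w' eqT; apply: eq_existsb => U; congr andb.
exact: determined_below_circuit eqT.
Qed.

(* The keys of a circuit other than [x] determine [x], so only one term of the sum over
   [x] is nonzero for a given set of other keys. *)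
Lemma sum_on_circuit_le i S M : #|S| = (M.*2 + 3)%N -> (32 * (M + 3) <= 9 * n)%N ->
  (forall V j, (j <= M)%N -> #|V| = j.+2.*2 -> Pr (level_circuit i V) <= circuit_bound j i) ->
  \sum_(x : key | x \notin S) Pr (on_circuit i S x) <= circuit_weight M * (3 / n%:R) ^+ i.+1.
Proof.
move=> cS Mn boundV.
apply: (@le_trans _ _ (\sum_(x : key | x \notin S) \sum_(U : {set key} | U \subset S)
    Pr (level_circuit i (x |: U)))).
  by apply: ler_sum => x _; apply: Pr_exists_le.
rewrite exchange_big /=.
apply: (le_trans (sum_subsets_le (size_of := fun j => (j.*2 + 3)%N) (N := M.+1)
  (h := fun j => circuit_bound j i) _ _ _)).
- by move=> j; rewrite cS leq_add2r leq_double.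
- by move=> j; apply: circuit_bound_ge0.
- move=> U sU; pose x0 := \sum_(y in U) y.
  have notinU x : x \notin S -> x \notin U by apply: contra; apply: subsetP.
  have only x : x \notin S -> Pr (level_circuit i (x |: U)) != 0 -> x = x0.
    move=> /notinU xU /Pr_neq0[w cw]; rewrite /x0 -(setU1K xU).
    by rewrite -(level_circuit_last cw (setU11 _ _)).
  rewrite psumr_neq0 => [/hasP[x _ /andP[xS Px]]|x _]; last exact: Pr_ge0.
  have Px0 : Pr (level_circuit i (x |: U)) != 0 by rewrite gt_eqF.
  have [w /level_circuit_card[j cj]] := Pr_neq0 Px0.
  have cU : #|U| = (j.*2 + 3)%N.
    by rewrite -(cardsD1_double cj (setU11 _ _)) setU1K ?notinU.
  have jM : (j <= M)%N by have := subset_leq_card sU; rewrite cU cS; lia.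
  exists j => //; rewrite (bigD1 x) //= big1 ?addr0; first exact: boundV.
  move=> y /andP[yS yx]; apply: contraNeq yx => Py.
  by rewrite (only y yS Py) (only x xS Px0).
rewrite cS; have -> : \sum_(j < M.+1) 'C(M.*2 + 3, j.*2 + 3)%:R * circuit_bound j i =
    (\sum_(j < M.+1) circuit_coef M j * circuit_weight j / n%:R ^+ j) * (3 / n%:R) ^+ i.+1.
  rewrite mulr_suml; apply: eq_bigr => j _; rewrite /circuit_bound /circuit_coef natrM.
  by move: (_ ^- j) (_ ^+ i.+1) => A B; ring.
by rewrite ler_wpM2r ?exprn_ge0 ?divr_ge0 ?ler0n // circuit_weight_sum_le.
Qed.

Lemma Pr_level_circuit_le i V M : (i <= d)%N -> (32 * (M + 3) <= 9 * n)%N -> #|V| = M.+2.*2 ->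
  Pr (level_circuit i V) <= circuit_bound M i.
Proof.
have coef0 j : 0 <= (odd_fact j.+2)%:R / n%:R ^+ j.+1 :> rat.
  by rewrite divr_ge0 ?exprn_ge0 ?ler0n.
elim: i V M => [|i IH] V M le_id Mn cV; rewrite -circuit_bound_step.
  apply: (le_trans (Pr_level_circuit_step (E := predT) le_id _ _ cV)) => //.
  rewrite ler_wpM2l // expr0 mulr1; apply: le_trans (Pr_le1 _) (circuit_weight_ge1 M).
have /card_gt0P[x Vx] : (0 < #|V|)%N by rewrite cV.
have cVx := cardsD1_double cV Vx.
apply: (le_trans (Pr_level_circuit_step (E := on_circuit i (V :\ x) x) le_id _ _ cV)).
- exact/determined_below_on_circuit/ltnW.
- move=> w /and3P[V0 zV _].
  have [C [cC Cx sC]] := zero_sum_circuit (zero_sum_leq (leqnSn _) zV) Vx.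
  by apply/existsP; exists (C :\ x); rewrite setSD // setD1K.
rewrite ler_wpM2l //; apply: le_trans (sum_on_circuit_le cVx Mn _); last first.
  by move=> U j jM cU; apply: (IH U j (ltnW le_id) _ cU); lia.
rewrite (bigD1 x) ?inE ?eqxx //= ler_wpDr // sumr_ge0 // => y _.
exact: Pr_ge0.
Qed.

Lemma sum_on_circuit i S M : (i <= d)%N -> #|S| = (M.*2 + 3)%N -> (32 * (M + 3) <= 9 * n)%N ->
  \sum_(x : key | x \notin S) Pr (on_circuit i S x) <= circuit_weight M * (3 / n%:R) ^+ i.+1.
Proof.
move=> le_id cS Mn; apply: (sum_on_circuit_le cS Mn) => V j jM cV.
by apply: (Pr_level_circuit_le le_id _ cV); lia.
Qed.

End Circuits.

(** * Obstructions *)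

Local Close Scope ring_scope.

Lemma lex_minimal_set (K : finType) (Q : {set K}) (P : pred {set K}) Z0 : P Z0 ->
  exists Z, [/\ P Z, forall W : {set K}, W \subset Z -> P W -> W = Z &
    forall W, P W -> #|Z :\: Q| <= #|W :\: Q|].
Proof.
move=> PZ0; pose size_of (Z : {set K}) := #|Z :\: Q| * #|K|.+1 + #|Z|.
case: (@arg_minnP _ Z0 P size_of PZ0) => Z PZ minZ; exists Z; split=> // W.
  move=> sW PW; apply/eqP; rewrite eqEcard sW /=.
  by have := minZ W PW; have := subset_leq_card (setSD Q sW); rewrite /size_of; nia.
by move=> PW; have := minZ W PW; have := max_card W; rewrite /size_of; nia.
Qed.

Section Obstructions.
Variables (k r c d : nat).
Hypotheses (c_gt0 : 0 < c) (d_gt0 : 0 < d).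
Local Notation Om := (tables k r c d).
Local Notation key := (key k c).
Variables (Q : {set key}) (f : key -> bits r -> {ffun qtype Q -> bits r} -> bool).
Local Notation key_map := {ffun key -> key}.
Implicit Types (x y : key) (S V W X Z : {set key}) (w : Om) (p q : key * key_map).

Lemma lin_dependent_zero_sum w X : lin_dependent [set derived_key w x | x in X] ->
  exists Z, [/\ Z \subset X, Z != set0 & zero_sum (key_row w) Z].
Proof.
case/existsP => Y /and3P[Y0 /subsetP sY /forallP evenY].
pose Z := [set x in X | derived_key w x \in Y].
have imZ : [set derived_key w x | x in Z] = Y.
  apply/setP => u; apply/imsetP/idP => [[x + ->]|uY]; first by rewrite inE => /andP[].
  by have /imsetP[x xX e] := sY u uY; exists x; rewrite // inE xX -e.
have derived_inj : injective (derived_key w).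
  move=> x y /ffunP exy; apply: (level_row_inj c_gt0 (T := w.1) (i := d)).
  by apply/ffunP => -[j b]; have := exy j; rewrite !derived_keyE !ffunE /= => ->.
exists Z; split; first by apply/subsetP => x; rewrite inE => /andP[].
  by rewrite -(imset_eq0 (derived_key w)) imZ.
apply/eqP/ffunP => -[j b]; rewrite sum_ffunE ffunE.
transitivity (\sum_(x in Z) (derived_key w x j == b) : bool)%R.
  by apply: eq_bigr => x _; rewrite ffunE derived_keyE /= (_ : j < _)%N //; have := ltn_ord j; lia.
rewrite -(big_imset (fun u : Defs.key k (c + d) => u j == b)) ?imZ; last first.
  by move=> x y _ _ /derived_inj.
by have /forallP/(_ b)/negbTE := evenY j; rewrite odd_card_set.
Qed.

Lemma lin_dependent_minimal_circuit w :
  lin_dependent [set derived_key w x | x in selected f w] ->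
  exists Z, [/\ Z \subset selected f w, circuit (key_row w) Z &
    forall W, W \subset selected f w -> W != set0 -> zero_sum (key_row w) W ->
      #|Z :\: Q| <= #|W :\: Q|].
Proof.
move=> /lin_dependent_zero_sum[Z0 [sZ0 nZ0 zZ0]].
pose P Z := [&& Z \subset selected f w, Z != set0 & zero_sum (key_row w) Z].
have PZ0 : P Z0 by apply/and3P.
have [Z [/and3P[sZ nZ zZ] minZ minQ]] := lex_minimal_set Q PZ0.
exists Z; split=> // [|W sW nW zW]; last by apply: minQ; apply/and3P.
apply/and3P; split=> //; apply/forallP => W; apply/implyP => /and3P[sW nW zW].
by apply/eqP/minZ => //; apply/and3P; split=> //; apply: subset_trans sZ.
Qed.

Definition near_matchings S : {set key * key_map} :=
  [set p | (p.1 \in S) && (p.2 \in matchings (S :\ p.1))].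

Definition independent_edges i S p w :=
  stable_zero_sum_free (level_row w.1 i) p.2 (S :\ p.1) && matched w.1 i p.2 (S :\ p.1).

Definition free_selected S w :=
  (S \subset selected f w) && ((S \subset Q) || zero_sum_free (key_row w) (S :|: Q)).

Definition obstruction (L : pred Om) S p q w :=
  [&& L w, independent_edges d.-1 S p w, independent_edges d S q w & free_selected S w].

(* If [d > 1], the removed end [x] of the path lies on a circuit of level [d - 2]. If
   [d = 1], it is the sum of the other keys of a set of matched edges. *)
Definition last_key S p x : pred Om :=
  if d.-1 is d'.+1 then on_circuit d' S x
  else fun=> [exists W : {set key}, [&& W \subset S :\ p.1, stable p.2 W &
                x == p.1 + \sum_(y in W) y]]%R.

Definition short_obstruction M w :=
  [exists S : {set key}, (#|S| == M.*2 + 3) && [exists p in near_matchings S,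
    [exists q in near_matchings S, [exists (x | x \notin S),
      obstruction (last_key S p x) S p q w]]]].

Definition truncated_obstruction M w :=
  [exists S : {set key}, (#|S| == M.*2 + 3) && [exists p in near_matchings S,
    [exists q in near_matchings S, obstruction predT S p q w]]].

Definition near_matching S x u (a : key -> key) := (u, restrict (S :\: [set x; u]) a).

Lemma mem_near_matching S x u a : u \in S :\ x -> matching a (S :\: [set x; u]) ->
  near_matching S x u a \in near_matchings (S :\ x).
Proof. by move=> uS aS; rewrite inE uS /= setDDl restrict_matchings. Qed.

Lemma independent_edges_near_matching i S x u a w :
  independent_edges i (S :\ x) (near_matching S x u a) w =
  stable_zero_sum_free (level_row w.1 i) a (S :\: [set x; u])
    && matched w.1 i a (S :\: [set x; u]).
Proof.
rewrite /independent_edges /= setDDl (eq_matched _ _ (restrictE a)).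
by rewrite (eq_stable_zero_sum_free _ (restrictE a)).
Qed.

Section MinimalCircuit.
Variables (w : Om) (Z : {set key}) (alpha beta : key -> key) (z : key).
Hypotheses (f_sel : selector f) (sZ : Z \subset selected f w) (circuitZ : circuit (key_row w) Z)
  (minQ : forall W, W \subset selected f w -> W != set0 -> zero_sum (key_row w) W ->
     #|Z :\: Q| <= #|W :\: Q|)
  (alphaZ : matching alpha Z) (alpha_matched : matched w.1 d.-1 alpha Z)
  (betaZ : matching beta Z) (beta_matched : matched w.1 d beta Z)
  (Zz : z \in Z) (zQ : (Z \subset Q) || (z \notin Q)).

Local Notation path S x y := (alternating_path Z alpha beta z S x y).

Lemma alternating_path_free_selected S x y : path S x y -> free_selected (S :\ x) w.
Proof.
move=> pS; have sS'Z : S :\ x \subset Z.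
  exact: subset_trans (subsetDl _ _) (alternating_path_sub pS).
rewrite /free_selected (subset_trans sS'Z sZ) /=.
case/orP: zQ => [sZQ|zNQ]; first by rewrite (subset_trans sS'Z).
apply/orP; right; apply/zero_sum_freeP => W sW zW; apply/eqP; apply: contraT => W0.
have zNW : z \notin W.
  apply/negP => /(subsetP sW); rewrite in_setU (negbTE zNQ) orbF.
  by apply/negP; apply: alternating_path_avoid pS.
have sWX : W \subset selected f w.
  apply: subset_trans sW _; rewrite subUset (subset_trans sS'Z sZ).
  by apply/subsetP => x' x'Q; rewrite inE f_sel.
have := minQ sWX W0 zW; rewrite leqNgt => /negP[].
apply: proper_card; apply/properP; split; last by exists z; rewrite inE zNQ.
apply/subsetP => u; rewrite !inE => /andP[uQ /(subsetP sW)].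
by rewrite in_setU (negbTE uQ) orbF => /(subsetP sS'Z) ->.
Qed.

Lemma alternating_path_upper_edges S x y : path S x y ->
  independent_edges d (S :\ x) (near_matching S x y beta) w.
Proof.
move=> pS; have sS := alternating_path_sub pS.
have sS'Z : S :\: [set x; y] \subset Z := subset_trans (subsetDl _ _) sS.
rewrite independent_edges_near_matching (matched_sub beta_matched sS'Z) andbT.
apply/forallP => W; apply/implyP => /and3P[sW betaW W0]; apply/negP => zW.
have sWZ := subset_trans sW sS'Z; have bW := matching_sub betaZ sWZ betaW.
have eW := circuit_min circuitZ sWZ W0 (zero_sum_matched bW (matched_sub beta_matched sWZ) zW).
have := subsetP sW x; rewrite eW (subsetP sS) ?(alternating_path_left pS) //.
by rewrite !inE eqxx => /(_ isT).
Qed.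

Lemma alternating_path_obstruction (L : pred Om) S x y : path S x y ->
  stable_zero_sum_free (level_row w.1 d.-1) alpha (S :\: edge alpha x) -> L w ->
  [/\ near_matching S x (alpha x) alpha \in near_matchings (S :\ x),
      near_matching S x y beta \in near_matchings (S :\ x) &
      obstruction L (S :\ x) (near_matching S x (alpha x) alpha) (near_matching S x y beta) w].
Proof.
move=> pS freeS Lw; have aS := alternating_path_matching alphaZ pS.
have Sx := alternating_path_left pS; have [Sax axx _] := matchingP aS Sx.
have sS'Z : S :\: edge alpha x \subset Z.
  exact: subset_trans (subsetDl _ _) (alternating_path_sub pS).
split.
- by apply: mem_near_matching; [rewrite !inE axx|apply: matchingD_edge].
- have /and5P[_ _ _ Sy /andP[xy _]] := pS.
  apply: mem_near_matching; first by rewrite !inE eq_sym xy.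
  exact: (alternating_path_interior betaZ pS).
apply/and4P; split=> //; last exact: alternating_path_free_selected pS.
  by rewrite independent_edges_near_matching freeS (matched_sub alpha_matched).
exact: alternating_path_upper_edges.
Qed.

Lemma zero_sum_pred_level V : V \subset Z -> stable alpha V ->
  zero_sum (level_row w.1 d.-1) V -> zero_sum (level_row w.1 d.-1.+1) V.
Proof.
move=> sV alphaV; apply: (zero_sum_matched (a := alpha)).
  exact: matching_sub alphaZ sV alphaV.
exact: matched_sub alpha_matched sV.
Qed.

Lemma last_keyP S x y V : path S x y -> V \subset S -> stable alpha V -> x \in V ->
  zero_sum (level_row w.1 d.-1) V ->
  last_key (S :\ x) (near_matching S x (alpha x) alpha) x w.
Proof.
move=> pS sV alphaV Vx zV; have sVZ := subset_trans sV (alternating_path_sub pS).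
have zV' := zero_sum_pred_level sVZ alphaV zV.
have aV := matching_sub alphaZ sVZ alphaV; have [Vax axx _] := matchingP aV Vx.
rewrite /last_key; case: (d.-1) zV zV' => [|d'] zV zV'; last first.
  have [C [cC Cx sC]] := zero_sum_circuit zV Vx.
  by apply/existsP; exists (C :\ x); rewrite setSD ?(subset_trans sC) //= setD1K.
apply/existsP; exists (V :\: edge alpha x).
have sW : V :\: edge alpha x \subset S :\: edge alpha x by rewrite setSD.
rewrite setDDl sW /= (eq_stable (sub_in1 (subsetP sW) (restrictE alpha))).
rewrite (stableD_edge aV Vx) /= {1}(zero_sum_last c_gt0 zV' Vx).
by rewrite (big_setD1 (alpha x)) ?inE ?axx //= setDDl.
Qed.

Lemma minimal_circuit_path : exists S x y V,
  [/\ path S x y, 2 < #|S|,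
      stable_zero_sum_free (level_row w.1 d.-1) alpha (S :\: edge alpha x) &
      [/\ V \subset S, stable alpha V, x \in V & zero_sum (level_row w.1 d.-1) V]].
Proof.
apply: alternating_critical => //.
  move=> V sV alphaV V0 /(zero_sum_pred_level sV alphaV) zV.
  by have [v ->] := zero_sum_card c_gt0 zV V0; rewrite !doubleS.
have /and3P[nZ zZ _] := circuitZ; apply: contraNN nZ => freeZ.
apply/eqP/(stable_zero_sum_freeP freeZ) => //; first exact: matching_stable.
exact: zero_sum_leq (leq_trans (leq_pred d) (leqnSn d)) zZ.
Qed.

Lemma minimal_circuit_obstruction N :
  (exists2 M, M < N & short_obstruction M w) \/ truncated_obstruction N w.
Proof.
have [S [x [y [V [pS S2 freeS [sV alphaV Vx zV]]]]]] := minimal_circuit_path.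
have cS := card_matching (alternating_path_matching alphaZ pS).
have [[|[|M]] cSM] : exists m, #|S| = m.*2 by exists #|edge_reps alpha S|.
- by rewrite cSM in S2.
- by rewrite cSM in S2.
case: (ltnP M N) => [ltMN|leNM].
  left; exists M => //; have last_x := last_keyP pS sV alphaV Vx zV.
  have [pP qP obs] := alternating_path_obstruction pS freeS last_x.
  apply/existsP; exists (S :\ x); rewrite (cardsD1_double cSM (alternating_path_left pS)) eqxx.
  apply/exists_inP; exists (near_matching S x (alpha x) alpha) => //.
  apply/exists_inP; exists (near_matching S x y beta) => //.
  by apply/existsP; exists x; rewrite !inE eqxx.
right; have leS : N.+2.*2 <= #|S| by rewrite cSM leq_double.
have [S' [x' [y' [pS' cS' sS']]]] := alternating_shrink alphaZ betaZ pS (ltn0Sn _) leS.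
have [pP qP obs] :=
  alternating_path_obstruction (L := predT) pS' (stable_zero_sum_freeS freeS sS') isT.
apply/existsP; exists (S' :\ x'); rewrite (cardsD1_double cS' (alternating_path_left pS')) eqxx.
apply/exists_inP; exists (near_matching S' x' (alpha x') alpha) => //.
by apply/exists_inP; exists (near_matching S' x' y' beta).
Qed.

End MinimalCircuit.

Lemma lin_dependent_obstruction w N : selector f ->
  lin_dependent [set derived_key w x | x in selected f w] ->
  (exists2 M, M < N & short_obstruction M w) \/ truncated_obstruction N w.
Proof.
move=> f_sel /lin_dependent_minimal_circuit[Z [sZ circuitZ minQ]].
have /and3P[nZ zZ _] := circuitZ.
have [z Zz zQ] : exists2 z, z \in Z & (Z \subset Q) || (z \notin Q).
  have [sZQ|] := boolP (Z \subset Q); last by case/subsetPn => z zZ' zQ; exists z.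
  by case/set0Pn: nZ => z zZ'; exists z.
have zZ1 : zero_sum (level_row w.1 d.-1.+1) Z by apply: zero_sum_leq zZ; rewrite prednK.
have [alpha aZ ma] := zero_sum_matching c_gt0 zZ1 (leq_pred d).
have [beta bZ mb] := zero_sum_matching c_gt0 zZ (leqnn d).
apply: (minimal_circuit_obstruction f_sel sZ circuitZ minQ _ ma _ mb Zz zQ).
  exact: matchings_matching.
exact: matchings_matching.
Qed.

End Obstructions.

(** * The union bound *)

Local Open Scope ring_scope.

Section SumProdSubsets.
Variables (R : numFieldType) (K : finType) (g : K -> R).
Hypothesis g_ge0 : forall x, 0 <= g x.

Definition sum_prod_subsets N := \sum_(S : {set K} | #|S| == N) \prod_(x in S) g x.

Lemma sum_prod_subsetsS_le N :
  sum_prod_subsets N.+1 * N.+1%:R <= sum_prod_subsets N * \sum_x g x.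
Proof.
have -> : sum_prod_subsets N.+1 * N.+1%:R =
    \sum_(S : {set K} | #|S| == N.+1) \sum_(x in S) g x * \prod_(y in S :\ x) g y.
  rewrite mulr_suml; apply: eq_bigr => S /eqP cS.
  rewrite [RHS](eq_bigr (fun=> \prod_(x in S) g x)) => [|x xS]; last by rewrite [RHS](big_setD1 x).
  by rewrite sumr_const cS mulr_natr.
rewrite (exchange_big_dep predT) //= mulrC mulr_suml; apply: ler_sum => x _.
rewrite -mulr_sumr ler_wpM2l // /sum_prod_subsets.
rewrite (reindex_onto (fun S => x |: S) (fun S => S :\ x)) /=; last first.
  by move=> S /andP[_ xS]; rewrite setD1K.
rewrite big_mkcond [leRHS]big_mkcond; apply: ler_sum => S _ /=.
have [xS|xS] := boolP (x \in S).
  have -> : (x |: S) :\ x == S = false by apply/eqP => e; move: xS; rewrite -e !inE eqxx.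
  by rewrite andbF; case: ifP => // _; apply: prodr_ge0.
by rewrite cardsU1 xS setU1K // setU11 eqxx !andbT eqSS.
Qed.

Lemma sum_prod_subsets_le N : sum_prod_subsets N <= (\sum_x g x) ^+ N / N`!%:R.
Proof.
have fact_gt0R m : 0 < m`!%:R :> R by rewrite ltr0n fact_gt0.
rewrite ler_pdivlMr //; elim: N => [|N IH].
  rewrite /sum_prod_subsets (eq_bigl (pred1 set0)) => [|S]; last by rewrite cards_eq0.
  by rewrite big_pred1_eq big_set0 fact0 mulr1 expr0.
rewrite factS natrM mulrA exprSr.
apply: (le_trans (ler_wpM2r (ltW (fact_gt0R N)) (sum_prod_subsetsS_le N))).
by rewrite mulrAC ler_wpM2r // sumr_ge0.
Qed.

End SumProdSubsets.

Section UnionBound.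
Variables (k r c d : nat).
Local Notation n := #|{: bits k}|.
Hypotheses (n_ge256 : (256 <= n)%N) (c_gt0 : (0 < c)%N) (d_gt0 : (0 < d)%N).
Local Notation Om := (tables k r c d).
Local Notation key := (key k c).
Variables (Q : {set key}) (f : key -> bits r -> {ffun qtype Q -> bits r} -> bool).
Hypothesis f_sel : selector f.
Local Notation key_map := {ffun key -> key}.
Implicit Types (x y : key) (S V W : {set key}) (w : Om) (p q : key * key_map).

Let nR_gt0 : 0 < n%:R :> rat := card_bits_gt0 k.

Lemma card_near_matchings S M : #|S| = (M.*2 + 3)%N -> (#|near_matchings S| <= odd_fact M.+2)%N.
Proof.
move=> cS.
have -> : #|near_matchings S| = (\sum_(u in S) #|matchings (S :\ u)|)%N.
  under eq_bigr do rewrite -sum1_card; rewrite pair_big_dep -sum1_card.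
  by apply: eq_bigl => p; rewrite inE.
apply: (@leq_trans (\sum_(u in S) odd_fact M.+1)%N).
  by apply: leq_sum => u Su; apply: card_matchings; apply: cardsD1_odd.
by rewrite sum_nat_const cS (odd_factS M.+1) mulnC leq_mul2l; lia.
Qed.

Lemma determined_below_independent_edges i S p : (i <= d)%N ->
  determined_below i.+1 (independent_edges i S p : pred Om).
Proof.
move=> le_id; apply: determined_belowI; last exact: determined_below_matched.
apply: (determined_belowS (leqnSn i)).
by apply: determined_below_stable_zero_sum_free; rewrite // ltnW.
Qed.

Lemma Pr_independent_edges i (E : pred Om) S p M : (i <= d)%N -> determined_below i E ->
  #|S| = (M.*2 + 3)%N -> p \in near_matchings S ->
  Pr (fun w => E w && independent_edges i S p w) <= Pr E / n%:R ^+ M.+1.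
Proof.
move=> le_id detE cS; rewrite inE => /andP[pS pM].
exact: (Pr_matched c_gt0 le_id detE (matchings_matching pM) (cardsD1_odd cS pS)).
Qed.

Lemma Pr_obstruction (L : pred Om) S p q M : determined_below d.-1 L -> #|S| = (M.*2 + 3)%N ->
  p \in near_matchings S -> q \in near_matchings S ->
  Pr (obstruction f L S p q) <= (\prod_(x in S) pf f x) * (Pr L / n%:R ^+ M.+1 / n%:R ^+ M.+1).
Proof.
move=> detL cS pS qS.
pose lower w := L w && independent_edges d.-1 S p w.
pose both w := lower w && independent_edges d S q w.
have det_lower : determined_below d lower.
  apply: determined_belowI; first exact: determined_belowS (leq_pred d) detL.
  apply: (determined_belowS (i := d.-1.+1)); first by rewrite prednK.
  exact: determined_below_independent_edges (leq_pred d).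
have det_both : determined_below d.+1 both.
  apply: determined_belowI; first exact: determined_belowS det_lower.
  exact: determined_below_independent_edges.
apply: (@le_trans _ _ ((\prod_(x in S) pf f x) * Pr both)).
  apply: le_trans (Pr_selected c_gt0 f_sel S _); last first.
    by move=> w w' ew; apply: det_both => j _; rewrite ew.
  by apply: le_Pr => w; rewrite /both /lower => /and4P[-> -> -> /andP[-> ->]].
rewrite ler_wpM2l ?prod_pf_ge0 //; apply: le_trans (Pr_independent_edges _ det_lower cS qS) _ => //.
rewrite ler_wpM2r ?invr_ge0 ?exprn_ge0 ?ler0n //.
exact: Pr_independent_edges (leq_pred d) detL cS pS.
Qed.

Lemma determined_below_last_key S p x : determined_below d.-1 (last_key S p x : pred Om).
Proof.
rewrite /last_key; case: (d.-1) (leq_pred d) => [|d'] d'd w w' eqT; first exact: erefl.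
exact: determined_below_on_circuit (ltnW d'd) w w' eqT.
Qed.

Lemma sum_stable_completions_le S p M : #|S| = (M.*2 + 3)%N -> p \in near_matchings S ->
  \sum_x Pr (fun _ : Om => [exists W : {set key},
    [&& W \subset S :\ p.1, stable p.2 W & x == p.1 + \sum_(y in W) y]]) <= 2 ^+ M.+1.
Proof.
move=> cS; rewrite inE => /andP[pS /matchings_matching pM].
pose stables := [set W : {set key} | (W \subset S :\ p.1) && stable p.2 W].
apply: (@le_trans _ _ (\sum_x \sum_(W in stables) (x == p.1 + \sum_(y in W) y)%:R)).
  apply: ler_sum => x _; set E := fun=> _; have [->|/Pr_neq0[w]] := eqVneq (Pr E) 0.
    by apply: sumr_ge0 => W _; apply: ler0n.
  case/existsP => W /and3P[sW pW /eqP xE]; apply: le_trans (Pr_le1 _) _.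
  rewrite (bigD1 W) ?inE ?sW //= -xE eqxx lerDl.
  by apply: sumr_ge0 => W' _; apply: ler0n.
rewrite exchange_big /= (eq_bigr (fun=> 1)) => [|W _]; last first.
  rewrite (bigD1 (p.1 + \sum_(y in W) y)) //= eqxx big1 ?addr0 // => x /negPf.
  by move->.
rewrite sumr_const -natrX ler_nat; apply: leq_trans (card_stable_subsets pM) _.
by rewrite leq_exp2l // -leq_double -(card_matching pM) (cardsD1_odd cS pS).
Qed.

Lemma sum_last_key_le S p M : #|S| = (M.*2 + 3)%N -> (32 * (M + 3) <= 9 * n)%N ->
  p \in near_matchings S ->
  \sum_(x | x \notin S) Pr (last_key S p x : pred Om) <= 5 * 3 ^+ M * (3 / n%:R) ^+ d.-1.
Proof.
move=> cS Mn pS; rewrite /last_key; case E : d.-1 => [|d'].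
  rewrite expr0 mulr1; apply: (@le_trans _ _ (2 ^+ M.+1)).
    apply: le_trans (sum_stable_completions_le cS pS).
    rewrite big_mkcond; apply: ler_sum => x _; case: ifP => // _; exact: Pr_ge0.
  have : (2 : rat) ^+ M <= 3 ^+ M by apply: lerXn2r; rewrite ?nnegrE; lra.
  have : (0 : rat) <= 2 ^+ M by apply: exprn_ge0.
  rewrite exprS; lra.
have d'd : (d' <= d)%N by rewrite -ltnS -E; apply: leq_trans (leq_pred d) _.
apply: le_trans (sum_on_circuit r n_ge256 c_gt0 d'd cS Mn) _.
by rewrite ler_wpM2r ?exprn_ge0 ?divr_ge0 ?ler0n // circuit_weight_le.
Qed.

(* The choice of [S] contributes the factor [muf f ^+ (2M + 3) / (2M + 3)!]. *)
Lemma sum_obstructions_le M (F : {set key} -> key * key_map -> key * key_map -> rat) (G : rat) :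
  0 <= G ->
  (forall S p q, #|S| = (M.*2 + 3)%N -> p \in near_matchings S -> q \in near_matchings S ->
     F S p q <= (\prod_(x in S) pf f x) * (G / n%:R ^+ M.+1 / n%:R ^+ M.+1)) ->
  \sum_(S : {set key} | #|S| == (M.*2 + 3)%N)
    \sum_(p in near_matchings S) \sum_(q in near_matchings S) F S p q
  <= matching_ratio M * G * (muf f / n%:R) ^+ M.*2 * (muf f ^+ 3 / n%:R ^+ 2).
Proof.
move=> G0 leF; set B := G / n%:R ^+ M.+1 / n%:R ^+ M.+1 in leF.
have B0 : 0 <= B by rewrite !divr_ge0 // exprn_ge0 // ltW.
have term S : #|S| = (M.*2 + 3)%N ->
    \sum_(p in near_matchings S) \sum_(q in near_matchings S) F S p q <=
    (\prod_(x in S) pf f x) * (B * (odd_fact M.+2)%:R ^+ 2).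
  move=> cS; apply: (@le_trans _ _ (\sum_(p in near_matchings S)
      \sum_(q in near_matchings S) (\prod_(x in S) pf f x) * B)).
    by apply: ler_sum => p pS; apply: ler_sum => q qS; apply: leF.
  rewrite !sumr_const -mulrnA -[leLHS]mulr_natr mulrA.
  apply: ler_wpM2l; first by rewrite mulr_ge0 ?prod_pf_ge0.
  by rewrite expr2 -natrM ler_nat leq_mul // card_near_matchings.
apply: (@le_trans _ _ (sum_prod_subsets (pf f) (M.*2 + 3) * (B * (odd_fact M.+2)%:R ^+ 2))).
  by rewrite mulr_suml; apply: ler_sum => S /eqP /term.
apply: le_trans (ler_wpM2r _ (sum_prod_subsets_le (pf_ge0 f) _)) _.
  by rewrite mulr_ge0 ?exprn_ge0 ?ler0n.
have fact_neq0 : ((M.*2 + 3)`!)%:R != 0 :> rat by rewrite pnatr_eq0 -lt0n fact_gt0.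
have pow_neq0 : n%:R ^+ M != 0 :> rat by rewrite expf_neq0 // gt_eqF.
have expr_double (u : rat) : u ^+ M.*2 = u ^+ M * u ^+ M by rewrite -addnn exprD.
rewrite -/(muf f) /B /matching_ratio expr_div_n (exprD _ M.*2 3) !expr_double (exprS n%:R M).
have n_neq0 := lt0r_neq0 nR_gt0.
move: (_`!%:R) (muf f ^+ M) (n%:R ^+ M : rat) (n%:R : rat) (_%:R ^+ 2) fact_neq0 pow_neq0 n_neq0.
move=> fact mu_pow n_pow u matchings2 fact_neq0 pow_neq0 u_neq0.
by rewrite le_eqVlt; apply/orP; left; apply/eqP; field; rewrite u_neq0 pow_neq0 fact_neq0.
Qed.

Lemma Pr_short_obstruction M : (32 * (M + 3) <= 9 * n)%N ->
  Pr (short_obstruction f M : pred Om)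
  <= matching_ratio M * (5 * 3 ^+ M * (3 / n%:R) ^+ d.-1)
     * (muf f / n%:R) ^+ M.*2 * (muf f ^+ 3 / n%:R ^+ 2).
Proof.
move=> Mn; have G0 : 0 <= 5 * 3 ^+ M * (3 / n%:R) ^+ d.-1 :> rat.
  by rewrite !mulr_ge0 ?exprn_ge0 ?divr_ge0 ?ler0n.
apply: le_trans (sum_obstructions_le (F := fun S p q => \sum_(x | x \notin S)
    Pr (obstruction f (last_key S p x) S p q)) G0 _).
  apply: le_trans (Pr_exists_le _ _) _; apply: ler_sum => S _.
  apply: le_trans (Pr_exists_le _ _) _; apply: ler_sum => p _.
  by apply: le_trans (Pr_exists_le _ _) _; apply: ler_sum => q _; apply: Pr_exists_le.
move=> S p q cS pS qS.
apply: (@le_trans _ _ (\sum_(x | x \notin S) (\prod_(x in S) pf f x)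
    * (Pr (last_key S p x : pred Om) / n%:R ^+ M.+1 / n%:R ^+ M.+1))).
  by apply: ler_sum => x _; apply: Pr_obstruction => //; apply: determined_below_last_key.
rewrite -mulr_sumr -2!mulr_suml; apply: ler_wpM2l; first exact: prod_pf_ge0.
do 2!(apply: ler_wpM2r; first by rewrite invr_ge0 exprn_ge0 ?ler0n).
exact: sum_last_key_le.
Qed.

Lemma Pr_truncated_obstruction M :
  Pr (truncated_obstruction f M : pred Om)
  <= matching_ratio M * 1 * (muf f / n%:R) ^+ M.*2 * (muf f ^+ 3 / n%:R ^+ 2).
Proof.
apply: le_trans (sum_obstructions_le (F := fun S p q => Pr (obstruction f predT S p q : pred Om))
  ler01 _).
  apply: le_trans (Pr_exists_le _ _) _; apply: ler_sum => S _.
  by apply: le_trans (Pr_exists_le _ _) _; apply: ler_sum => p _; apply: Pr_exists_le.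
move=> S p q cS pS qS; apply: le_trans (Pr_obstruction (L := predT) _ cS pS qS) _ => //.
by rewrite ler_wpM2l ?prod_pf_ge0 // !ler_wpM2r ?invr_ge0 ?exprn_ge0 ?ler0n // Pr_le1.
Qed.

Lemma Pr_lin_dependent_le N :
  Pr (fun w : Om => lin_dependent [set derived_key w x | x in selected f w])
  <= \sum_(M < N) Pr (short_obstruction f M : pred Om) + Pr (truncated_obstruction f N : pred Om).
Proof.
apply: (@le_trans _ _ (Pr (fun w : Om => [exists (M : 'I_N | true), short_obstruction f M w]
    || truncated_obstruction f N w))); last first.
  by apply: le_trans (Pr_orb_le _ _) _; rewrite lerD2r Pr_exists_le.
apply: le_Pr => w /(lin_dependent_obstruction c_gt0 d_gt0 N f_sel).
case=> [[M MN shortM]|->]; last exact: orbT.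
by apply/orP; left; apply/existsP; exists (Ordinal MN).
Qed.

Hypothesis mu_le : muf f <= n%:R / 2.

Lemma muf_ratio_square_le : (muf f / n%:R) ^+ 2 <= 1 / 4.
Proof.
have ratio0 : 0 <= muf f / n%:R by rewrite divr_ge0 ?muf_ge0 // ltW.
have ratio_le : muf f / n%:R <= 1 / 2 by rewrite ler_pdivrMr // mulrC mulrA mulr1.
have := ler_pM ratio0 ratio0 ratio_le ratio_le; rewrite -expr2; lra.
Qed.

Lemma sum_short_obstruction_le N : (32 * (N + 2) <= 9 * n)%N ->
  \sum_(M < N) Pr (short_obstruction f M : pred Om) <= 7 * muf f ^+ 3 * (3 / n%:R) ^+ d.+1.
Proof.
move=> Nn; set x := (muf f / n%:R) ^+ 2.
set rest := (3 / n%:R) ^+ d.-1 * (muf f ^+ 3 / n%:R ^+ 2).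
have rest0 : 0 <= rest.
  by rewrite mulr_ge0 ?exprn_ge0 ?divr_ge0 ?exprn_ge0 ?muf_ge0 ?ler0n.
apply: (@le_trans _ _ (\sum_(M < N) matching_ratio M * (5 * 3 ^+ M) * x ^+ M * rest)).
  apply: ler_sum => M _; apply: le_trans (Pr_short_obstruction _) _.
    by have := ltn_ord M; lia.
  rewrite -mul2n exprM -/x /rest; move: (x ^+ M) (_ ^+ d.-1) (matching_ratio M) => a b e.
  by rewrite le_eqVlt; apply/orP; left; apply/eqP; ring.
rewrite -mulr_suml.
apply: le_trans (ler_wpM2r rest0 (matching_ratio_sum_le N (sqr_ge0 _) muf_ratio_square_le)) _.
have -> : 7 * muf f ^+ 3 * (3 / n%:R) ^+ d.+1 = 63 * rest.
  rewrite /rest -[in LHS](prednK d_gt0) !exprS.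
  by move: (_ ^+ d.-1) => u; field; rewrite lt0r_neq0.
by apply: (ler_wpM2r rest0); lra.
Qed.

Lemma Pr_truncated_obstruction_le m : (0 < m)%N -> n = (256 * m)%N ->
  Pr (truncated_obstruction f (72 * m - 2) : pred Om) <= 1 / (2 ^ (128 * m))%N%:R.
Proof.
move=> m0 nm; set N := (72 * m - 2)%N; set x := (muf f / n%:R) ^+ 2.
have x0 : 0 <= x := sqr_ge0 _; have N1 : N.+1 = (72 * m - 1)%N by rewrite /N; lia.
apply: le_trans (Pr_truncated_obstruction N) _.
have -> : matching_ratio N * 1 * (muf f / n%:R) ^+ N.*2 * (muf f ^+ 3 / n%:R ^+ 2) =
    matching_ratio N * x ^+ N.+1 * muf f.
  rewrite -mul2n exprM -/x (exprSr _ N); move: (x ^+ N) (matching_ratio N) => a b.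
  by rewrite /x; field; rewrite lt0r_neq0.
have ratio_le : matching_ratio N <= (72 * m)%N%:R.
  apply: le_trans (matching_ratio_le_linear N) _; rewrite -[2%R]/(2%:R) -natrD ler_nat /N; lia.
have pow_le : x ^+ N.+1 <= (1 / 4) ^+ N.+1 by apply: lerXn2r muf_ratio_square_le.
have mu_le' : muf f <= (128 * m)%N%:R.
  apply: le_trans mu_le _; rewrite nm (_ : 256 * m = 128 * m * 2)%N; last by lia.
  by rewrite natrM mulfK // pnatr_eq0.
have pow0 : 0 <= x ^+ N.+1 by apply: exprn_ge0.
apply: le_trans (ler_pM (mulr_ge0 (matching_ratio_ge0 N) pow0) (muf_ge0 f)
  (ler_pM (matching_ratio_ge0 N) pow0 ratio_le pow_le) mu_le') _.
rewrite N1; exact: truncation_estimate.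
Qed.

End UnionBound.

Theorem theorem1p4 (k r c d : nat) (Q : {set key k c})
    (f : key k c -> bits r -> {ffun qtype Q -> bits r} -> bool) :
  (8 <= k)%N -> (1 <= c)%N -> (1 <= d)%N -> selector f ->
  muf f <= (#|{: bits k}|%:R / 2) ->
  Pr (fun w : tables k r c d =>
        lin_dependent [set derived_key w x | x in selected f w])
  <= 7%:R * muf f ^+ 3 * (3%:R / #|{: bits k}|%:R) ^+ d.+1
     + 1 / (2 ^ (#|{: bits k}| %/ 2))%N%:R.
Proof.
move=> k8 c1 d1 f_sel mu_le.
set m := (2 ^ (k - 8))%N; have m0 : (0 < m)%N by rewrite expn_gt0.
have nm : #|{: bits k}| = (256 * m)%N.
  by rewrite card_bits -[256%N]/(2 ^ 8)%N -expnD subnKC.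
have n256 : (256 <= #|{: bits k}|)%N by rewrite nm; lia.
apply: le_trans (Pr_lin_dependent_le c1 d1 f_sel (72 * m - 2)) _; apply: lerD.
  by apply: (sum_short_obstruction_le n256 c1 d1 f_sel mu_le); rewrite nm; lia.
have -> : (#|{: bits k}| %/ 2 = 128 * m)%N by rewrite nm; lia.
exact: Pr_truncated_obstruction_le.
Qed.
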